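(* Let $f$ be a positive integer and for non-negative integers $n_1,\dots,n_f$ put $N_i:=n_i+n_{i+1}+\dots+n_f$ for $i=1,\dots,f$. Then for $|q|<1$, \begin{align*} &\sum_{m,n,n_1,\dots,n_f\geq 0}\frac{q^{2m^2+6mn+6n^2+m+3n+N_1^2+\dots+N_f^2+N_1+\dots+N_f}(q;q)_{n_f}}{(q;q)_m(q^3;q^3)_n(q;q)_{n_f-3n-2m}(q;q)_{n_1}\cdots(q;q)_{n_{f-1}}(q;q)_{2n_f+1}}\\ &\quad+q\sum_{m,n,n_1,\dots,n_f\geq 0}\frac{q^{2m^2+6mn+6n^2+3m+6n+N_1^2+\dots+N_f^2+N_1+\dots+N_f}(q;q)_{n_f}}{(q;q)_m(q^3;q^3)_n(q;q)_{n_f-3n-2m-1}(q;q)_{n_1}\cdots(q;q)_{n_{f-1}}(q;q)_{2n_f+1}} =\frac{(q^{2(f+1)};q^{2(f+1)})_\infty}{(q;q)_\infty}(q^{2(f+1)},q^{10(f+1)};q^{12(f+1)})_\infty. \end{align*}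
   Context: $(a;p)_n=\prod_{k=0}^{n-1}(1-ap^k)$ for a base $p$, $(a_1,\dots,a_k;p)_n=(a_1;p)_n\cdots(a_k;p)_n$, and for $|p|<1$, $(a;p)_\infty=\lim_{n\to\infty}(a;p)_n$. By convention $1/(q;q)_n=0$ for negative integers $n$, so summands with a negative index in a denominator vanish. *)

(* Defs.v *)
From HB Require Import structures.
From mathcomp Require Import all_boot all_order all_algebra.
From mathcomp Require Import complex.
From mathcomp Require Import all_classical all_reals all_analysis.
From mathcomp Require summability.

Set Implicit Arguments.
Unset Strict Implicit.
Unset Printing Implicit Defensive.

Import Order.TTheory GRing.Theory Num.Theory.
Import numFieldNormedType.Exports.

Local Open Scope classical_set_scope.
Local Open Scope ring_scope.

(* Everything is stated over a numFieldType [K], with the topology given by its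
   norm, and is meant to be used with [K := R[i]], [R : realType]. *)

Definition qpoch (K : numFieldType) (a p : K) (n : nat) : K :=
  \prod_(k < n) (1 - a * p ^+ k).

Definition qpoch_inf (K : numFieldType) (a p : K) : K :=
  lim (qpoch a p n @[n --> \oo]).

(* 1/(q;q)_k for k an integer, with the convention that it is 0 for k < 0 *)
Definition inv_qfact (K : numFieldType) (q : K) (k : int) : K :=
  if k is Posz n then (qpoch q q n)^-1 else 0.

(* Multiple series are unconditional sums: limits of the finite partial sums
   along the directed set of finite subsets of the index type. *)
Definition uncond_summable (I : choiceType) (K : numFieldType)
    (x : I -> K) : Prop :=
  cvg (summability.partial_sum x A @[A --> summability.totally]).

Definition uncond_sum (I : choiceType) (K : numFieldType) (x : I -> K) : K :=
  lim (summability.partial_sum x A @[A --> summability.totally]).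

Section Summands.
Variables (K : numFieldType) (f : nat) (q : K).

(* 1-based: [npart ns i] is n_i, for 1 <= i <= f *)
Definition npart (ns : f.-tuple nat) (i : nat) : nat := nth 0%N ns i.-1.

(* N_i = n_i + n_{i+1} + ... + n_f *)
Definition Npart (ns : f.-tuple nat) (i : nat) : nat :=
  (\sum_(i <= j < f.+1) npart ns j)%N.

Definition summand1 (x : nat * nat * f.-tuple nat) : K :=
  let: (m, n, ns) := x in
  let nf := npart ns f in
  q ^+ (2 * m ^ 2 + 6 * m * n + 6 * n ^ 2 + m + 3 * n
        + \sum_(1 <= i < f.+1) Npart ns i ^ 2
        + \sum_(1 <= i < f.+1) Npart ns i)%N
  * qpoch q q nf
  / (qpoch q q m * qpoch (q ^+ 3) (q ^+ 3) n
     * \prod_(1 <= i < f) qpoch q q (npart ns i)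
     * qpoch q q (2 * nf + 1)%N)
  * inv_qfact q (nf%:Z - (3 * n)%N%:Z - (2 * m)%N%:Z).

Definition summand2 (x : nat * nat * f.-tuple nat) : K :=
  let: (m, n, ns) := x in
  let nf := npart ns f in
  q ^+ (2 * m ^ 2 + 6 * m * n + 6 * n ^ 2 + 3 * m + 6 * n
        + \sum_(1 <= i < f.+1) Npart ns i ^ 2
        + \sum_(1 <= i < f.+1) Npart ns i)%N
  * qpoch q q nf
  / (qpoch q q m * qpoch (q ^+ 3) (q ^+ 3) n
     * \prod_(1 <= i < f) qpoch q q (npart ns i)
     * qpoch q q (2 * nf + 1)%N)
  * inv_qfact q (nf%:Z - (3 * n)%N%:Z - (2 * m)%N%:Z - 1).

End Summands.

(* Main.v *)
Require Import Defs.
From mathcomp Require Import all_boot all_order all_algebra.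
From mathcomp Require Import finmap complex.
From mathcomp Require Import all_classical all_reals all_analysis.
From mathcomp Require Import ring zify.

(* Write (q)_n for (q;q)_n. The sum over n_1, ..., n_f is an iterated Bailey
   lemma with a = q, so everything rests on the Bailey pair
     (q)_L/(q)_{2L+1} * (inner sums over m, n)
       = sum_{r=0}^L c_r q^(r^2+r) / ((q)_{L-r} (q)_{L+r+1}),
   where c_r = 1, -2, 1, 1, -2, 1, ... = - w^(r+2) - w^(2r+1) for a primitive
   cube root of unity w. The chain turns it into
   sum_r c_r q^((f+1)(r^2+r)) / (q)_oo, and the Jacobi triple product at w
   evaluates this theta series.

   The Bailey pair is the case z = w of an identity in a free parameter z:
     sum_{r in Z} z^(r+1) q^(r^2+r) [2L+1, L-r] = (1 + z) T_L[G_z],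
     G_z(y) = (-y, -zqy, -qy/z; q)_oo / (y^2; q)_oo,
   where T_L is the linear functional y^N |-> q^(N(N+1)/2) (q)_L/(q)_{L-N} on
   power series. It is proved by induction on L for all z at once: by
     T_{L+1}[F] - T_L[F] = q^(L+1) T_L[(F(y) - F(qy))/y],
     T_L[y F(y)] = q (T_L[F(qy)] - q^L T_L[F]),
   the recurrence of the left-hand side, which involves z, qz and z/q, becomes
   a polynomial identity, since G_z(y), G_z(qy), G_{qz} and G_{z/q} are all
   polynomial multiples of one power series.

   For the sums over all indices, absolute convergence allows one to sum along
   the finite sets m, n, N_1 <= M, where the partial sums are computed
   exactly; Tannery's theorem then gives the limit M -> oo. *)

Set Implicit Arguments.
Unset Strict Implicit.
Unset Printing Implicit Defensive.

Import Order.TTheory GRing.Theory Num.Theory.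
Import numFieldNormedType.Exports.
Import Normc.
Local Open Scope classical_set_scope.
Local Open Scope ring_scope.

(** * Power series and the functional T_L *)

Lemma qpochS (K : numFieldType) (a p : K) (n : nat) :
  qpoch a p n.+1 = qpoch a p n * (1 - a * p ^+ n).
Proof. by rewrite /qpoch big_ord_recr. Qed.

Lemma qpoch0 (K : numFieldType) (a p : K) : qpoch a p 0 = 1.
Proof. by rewrite /qpoch big_ord0. Qed.

Section PowerSeries.
Variable K : numFieldType.
Implicit Types a b : nat -> K.

(* Sequences are read as coefficients of power series in y: [shift_seq] is the
   product with y, [mul1X c] the product with 1 + c y, and [dilate q] the
   substitution of q y for y. *)
Definition shift_seq a (n : nat) : K := if n is m.+1 then a m else 0.

Definition cauchyM a b (n : nat) : K := \sum_(i < n.+1) a i * b (n - i)%N.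

Lemma cauchyMC a b : cauchyM a b = cauchyM b a.
Proof.
apply/funext => n; rewrite /cauchyM (reindex_inj rev_ord_inj) /=.
by apply: eq_bigr => i _; rewrite subSS mulrC subKn // -ltnS.
Qed.

Lemma cauchyM_shiftl a b : cauchyM (shift_seq a) b = shift_seq (cauchyM a b).
Proof.
apply/funext => -[|n]; rewrite /cauchyM /=; first by rewrite big_ord1 mul0r.
by rewrite big_ord_recl mul0r add0r.
Qed.

Lemma cauchyM_Dl a a' b (c : K) :
  cauchyM (fun i => a i + c * a' i) b = fun n => cauchyM a b n + c * cauchyM a'
      b n.
Proof.
apply/funext => n; rewrite /cauchyM mulr_sumr -big_split /=; apply: eq_bigr =>
    i _.
by rewrite mulrDl mulrA.
Qed.

Definition mul1X (c : K) a n := a n + c * shift_seq a n.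

Lemma cauchyM_mul1Xl c a b : cauchyM (mul1X c a) b = mul1X c (cauchyM a b).
Proof. by rewrite cauchyM_Dl cauchyM_shiftl. Qed.

Lemma cauchyM_mul1Xr c a b : cauchyM a (mul1X c b) = mul1X c (cauchyM a b).
Proof. by rewrite cauchyMC cauchyM_mul1Xl cauchyMC. Qed.

Lemma mul1XC c d a : mul1X c (mul1X d a) = mul1X d (mul1X c a).
Proof. by apply/funext => -[|n]; rewrite /mul1X /=; ring. Qed.

Definition dilate (q : K) a n := q ^+ n * a n.

Lemma dilate_cauchyM q a b :
  dilate q (cauchyM a b) = cauchyM (dilate q a) (dilate q b).
Proof.
apply/funext => n; rewrite /dilate /cauchyM mulr_sumr; apply: eq_bigr => i _.
rewrite mulrACA -exprD subnKC //; by rewrite -ltnS.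
Qed.

End PowerSeries.

Section Finite.
Variables (K : numFieldType) (q : K).
Hypothesis q_nonroot : forall n, 1 - q ^+ n.+1 != 0.

Local Notation qf := (qpoch q q).

Lemma qfS n : qf n.+1 = qf n * (1 - q ^+ n.+1).
Proof. by rewrite qpochS exprS. Qed.

Lemma qf_neq0 n : qf n != 0.
Proof.
elim: n => [|n IH]; first by rewrite qpoch0 oner_eq0.
by rewrite qfS mulf_neq0.
Qed.

(* Coefficients of (-cy;q)_oo *)
Definition qexp (c : K) n := c ^+ n * q ^+ 'C(n, 2) / qf n.

(** (-cy;q)_oo = (1 + cy) (-cqy;q)_oo, the first factor being split off. *)
Lemma qexp_step c : qexp c = mul1X c (qexp (c * q)).
Proof.
apply/funext => -[|n]; rewrite /mul1X /qexp /=.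
  by rewrite !expr0 mulr0 addr0.
rewrite qfS binS bin1 exprMn exprD !exprMn !exprS.
have := qf_neq0 n; have := q_nonroot n; rewrite exprS => h1 h2.
field; exact/andP.
Qed.

Lemma qexp_dilate c : dilate q (qexp c) = qexp (c * q).
Proof. by apply/funext => n; rewrite /dilate /qexp exprMn; ring. Qed.

(* Coefficients of 1/(y^2;q)_oo *)
Definition qgeom2 n : K := if odd n then 0 else (qf n./2)^-1.

(** Replacing y by qy in 1/(y^2;q)_oo removes the factors 1 - y^2 = (1 + y)(1 - y) and 1 - q y^2
    from the denominator. *)
Lemma qgeom2_dilate :
  dilate q qgeom2 =
  mul1X 1 (mul1X (-1)
    (fun n => qgeom2 n + (- q) * shift_seq (shift_seq qgeom2) n)).
Proof.
apply/funext => n; rewrite /dilate /mul1X /qgeom2.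
case: n => [|[|[|[|n]]]] /=; rewrite ?qpoch0 ?expr0 ?negbK; try by ring.
- have := q_nonroot 0; rewrite !qfS qpoch0 expr1 => h; field; exact: h.
- rewrite -[in q ^+ _](odd_double_half n); case: (odd n) => /=; first by ring.
  rewrite add0n !qfS; set k := n./2.
  have -> : k.*2.+4 = (2 * k + 4)%N by rewrite -mul2n; lia.
  have := qf_neq0 k; have := q_nonroot k; have := q_nonroot k.+1.
  rewrite !exprS exprD mulnC exprM => h1 h2 h3.
  by field; rewrite h1 h2 h3.
Qed.

(* Coefficients of (-ay, -by, -cy; q)_oo / (y^2; q)_oo *)
Definition Gprod (a b c : K) : nat -> K :=
  cauchyM (cauchyM (cauchyM (qexp a) (qexp b)) (qexp c)) qgeom2.

Lemma Gprod_step1 a b c : Gprod a b c = mul1X a (Gprod (a * q) b c).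
Proof. by rewrite /Gprod {1}(qexp_step a) !cauchyM_mul1Xl. Qed.

Lemma Gprod_step2 a b c : Gprod a b c = mul1X b (Gprod a (b * q) c).
Proof. by rewrite /Gprod {1}(qexp_step b) cauchyM_mul1Xr !cauchyM_mul1Xl. Qed.

Lemma Gprod_step3 a b c : Gprod a b c = mul1X c (Gprod a b (c * q)).
Proof. by rewrite /Gprod {1}(qexp_step c) cauchyM_mul1Xr cauchyM_mul1Xl. Qed.

(** With first parameter 1, the factor 1 + y gained from 1/(y^2;q)_oo turns (-qy;q)_oo back into
    (-y;q)_oo; what remains is (1 - y)(1 - q y^2). *)
Lemma Gprod_dilate b c :
  dilate q (Gprod 1 b c) =
  mul1X (-1) (fun n => Gprod 1 (b * q) (c * q) n
    + (- q) * shift_seq (shift_seq (Gprod 1 (b * q) (c * q))) n).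
Proof.
rewrite /Gprod !dilate_cauchyM !qexp_dilate qgeom2_dilate !cauchyM_mul1Xr.
rewrite mul1XC -!(cauchyM_mul1Xl 1) -(qexp_step 1); congr mul1X.
by rewrite [LHS]cauchyMC cauchyM_Dl !cauchyM_shiftl [cauchyM qgeom2 _]cauchyMC.
Qed.

Definition Gser (z : K) : nat -> K := Gprod 1 (q * z) (q / z).
(* The common factor of [Gser z], [Gser (q * z)], [Gser (z / q)] and
   [dilate q (Gser z)]. *)
Definition Hser (z : K) : nat -> K := Gprod 1 (q ^+ 2 * z) (q ^+ 2 / z).

Lemma GserE z : Gser z = mul1X (q * z) (mul1X (q / z) (Hser z)).
Proof.
rewrite /Gser Gprod_step2 Gprod_step3 /Hser.
by do 2!congr mul1X; congr Gprod; ring.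
Qed.

Section Nonzero.
Hypothesis q_neq0 : q != 0.

Lemma Gser_up z : z != 0 ->
  Gser (q * z) = mul1X z^-1 (mul1X (q / z) (Hser z)).
Proof.
move=> z0; rewrite /Gser Gprod_step3 Gprod_step3 /Hser.
by congr mul1X; [field; exact/andP | congr mul1X; [field; exact/andP |
  congr Gprod; [ring | field; exact/andP]]].
Qed.

Lemma Gser_down z : z != 0 ->
  Gser (z / q) = mul1X z (mul1X (q * z) (Hser z)).
Proof.
move=> z0; rewrite /Gser Gprod_step2 Gprod_step2 /Hser.
by congr mul1X; [field | congr mul1X; [field |
  congr Gprod; [field | field; exact/andP]]].
Qed.

End Nonzero.

Lemma Gser_dilate z : dilate q (Gser z) =
  mul1X (-1) (fun n => Hser z n + (- q) * shift_seq (shift_seq (Hser z)) n).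
Proof.
rewrite /Gser Gprod_dilate /Hser.
by rewrite (_ : q * z * q = q ^+ 2 * z) 1?(_ : q / z * q = q ^+ 2 / z) //; ring.
Qed.

Definition Tfun (L : nat) (a : nat -> K) : K :=
  \sum_(N < L.+1) q ^+ 'C(N.+1, 2) * (qf L / qf (L - N)%N) * a N.

Lemma Tfun_lin L a b (c d : K) :
  Tfun L (fun n => c * a n + d * b n) = c * Tfun L a + d * Tfun L b.
Proof.
by rewrite /Tfun !mulr_sumr -big_split; apply: eq_bigr => i _ /=; ring.
Qed.

(** The weights t_N = q^(N(N+1)/2) (q)_L/(q)_{L-N} satisfy t_{N+1} = q (q^N - q^L) t_N. *)
Lemma Tfun_shift L a :
  Tfun L (shift_seq a) = q * (Tfun L (dilate q a) - q ^+ L * Tfun L a).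
Proof.
rewrite {1}/Tfun big_ord_recl /= mulr0 add0r.
rewrite /Tfun mulr_sumr -sumrB mulr_sumr [RHS]big_ord_recr /=.
(* The term N = L vanishes since q^N = q^L there, so both sides run over N < L. *)
rewrite [X in _ = _ + X](_ : _ = 0) ?addr0; last by rewrite /dilate; ring.
apply: eq_bigr => i _ /=.
rewrite /bump /= add1n subnS binS bin1 exprD /dilate.
have -> : (L - i)%N = (L - i).-1.+1 by have := ltn_ord i; lia.
set k := (L - i).-1; rewrite qfS /=.
have -> : q ^+ L = q ^+ k.+1 * q ^+ i.
  by rewrite -exprD; congr (_ ^+ _); rewrite /k; have := ltn_ord i; lia.
have := qf_neq0 k; have := q_nonroot k => h1 h2.
rewrite (exprS q i) /=; field; exact/andP.
Qed.

(** From L to L + 1 the weight at N + 1 grows by q^(L+1) (1 - q^(N+1)) times the weight at N for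
    L. *)
Lemma Tfun_step L a :
  Tfun L.+1 a =
  Tfun L a + q ^+ L.+1 * Tfun L (fun n => (1 - q ^+ n.+1) * a n.+1).
Proof.
rewrite /Tfun [LHS]big_ord_recl [X in _ = X + _]big_ord_recl /=.
rewrite !subn0 !divff ?qf_neq0 // -addrA; congr (_ + _).
rewrite [LHS]big_ord_recr [X in _ = _ + _ * X]big_ord_recr /= mulrDr addrA.
have nz := qf_neq0; congr (_ + _).
  rewrite mulr_sumr -big_split /=; apply: eq_bigr => i _.
  rewrite /bump /= !add1n subSS subnS.
  have iL := ltn_ord i.
  have -> : (L - i)%N = (L - i).-1.+1 by lia.
  set k := (L - i).-1; rewrite [in 'C(i.+2, 2)]binS bin1 exprD qfS /= !qfS.
  have -> : q ^+ L.+1 = q ^+ k.+1 * q ^+ i.+1.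
    by rewrite -exprD; congr (_ ^+ _); rewrite /k; lia.
  have := q_nonroot k => h1.
  by field; rewrite h1 nz.
rewrite /bump /= !add1n !subnn qpoch0 qfS [in 'C(L.+2, 2)]binS bin1 exprD.
by field.
Qed.

Lemma Gser0 z : Gser z 0 = 1.
Proof.
by rewrite /Gser /Gprod /cauchyM !big_ord1 /= !subn0 /qexp /qgeom2 /= !qpoch0
  !expr0 ?bin0n ?expr0 ?divr1 ?mulr1 ?invr1.
Qed.

Lemma Tfun_Gser_step L z : q != 0 -> z != 0 ->
  (1 + z) * Tfun L.+1 (Gser z) =
  (1 + q ^+ (2 * L + 2)) * ((1 + z) * Tfun L (Gser z)) +
  q ^+ L.+1 * (z * ((1 + q * z) * Tfun L (Gser (q * z))) +
               q / z * ((1 + z / q) * Tfun L (Gser (z / q)))).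
Proof.
move=> q0 z0; rewrite Tfun_step.
pose d n := (1 - q ^+ n.+1) * Gser z n.+1.
pose u n := (1 + q * z) * z * Gser (q * z) n + (1 + q / z) * Gser (z / q) n.
(* [v] is chosen so that T_L[v] = q^(L+1) T_L[G_z]: by [Tfun_shift] the dilated parts cancel. *)
pose v n := q * dilate q (Gser z) n + (-1) * shift_seq (Gser z) n.
(* This is (1 + z)(G_z(y) - G_z(qy))/y = (1 + z) v + u; the zero multiple of [d] only fits it to
   [Tfun_lin]. *)
have key : (fun n => (1 + z) * d n + 0 * d n) = (fun n => (1 + z) * v n + 1 * u
    n).
  apply/funext => n; rewrite mul0r addr0 mul1r /v /u /d.
  rewrite mulrBl mul1r -[_ * Gser z n.+1]/(dilate q (Gser z) n.+1).
  rewrite !Gser_dilate Gser_up // Gser_down // !GserE /mul1X /=.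
  (* All series are now polynomials in y times H_z; the first two coefficients are separate because
     of the zeros that [shift_seq] brings in. *)
  by case: n => [|[|n]] /=; field; rewrite ?q0 ?z0.
have := congr1 (Tfun L) key; rewrite !Tfun_lin Tfun_shift mul0r addr0 -/d => e.
rewrite mulrDr [X in _ + X]mulrCA e (_ : (2 * L + 2 = L.+1 + L + 1)%N); last by
    lia.
by rewrite !exprD !exprS; field; rewrite q0 z0.
Qed.


(** * Gaussian binomials and the bilateral sum as a Laurent polynomial *)

Definition qbin (n k : nat) : K :=
  if (k <= n)%N then qf n / (qf k * qf (n - k)%N) else 0.

Lemma qbin0 n : qbin n 0 = 1.
Proof. by rewrite /qbin /= subn0 qpoch0 mul1r divff ?qf_neq0. Qed.

Lemma qbin_gt n k : (n < k)%N -> qbin n k = 0.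
Proof. by move=> nk; rewrite /qbin leqNgt nk. Qed.

Lemma qbin_sub n k : (k <= n)%N -> qbin n (n - k) = qbin n k.
Proof. by move=> kn; rewrite /qbin leq_subr kn subKn // [qf k * _]mulrC. Qed.

Lemma qbinn n : qbin n n = 1.
Proof. by rewrite -(qbin_sub (leqnn n)) subnn qbin0. Qed.

Lemma qbin_pascal n k :
  qbin n.+1 k.+1 = q ^+ k.+1 * qbin n k.+1 + qbin n k.
Proof.
have [nk|kn] := ltnP n k; first by rewrite !qbin_gt ?mulr0 ?addr0 //; lia.
have nz := qf_neq0; have := q_nonroot k => h1.
have [->|kn'] := eqVneq k n.
  rewrite [qbin n n.+1]qbin_gt // /qbin !leqnn !subnn qpoch0 !qfS; field.
  by rewrite nz q_nonroot.
rewrite /qbin ltnS kn; have -> : (k < n)%N by lia.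
rewrite subSS subnS; have -> : (n - k)%N = (n - k).-1.+1 by lia.
set j := (n - k).-1; have -> : n = (j + k.+1)%N by rewrite /j; lia.
rewrite /= !qfS (_ : q ^+ (j + k.+1).+1 = q ^+ j.+1 * q ^+ k.+1); last first.
  by rewrite -exprD addSn.
have := q_nonroot j => h2.
by field; rewrite !nz h1 h2.
Qed.

Lemma qbin_pascal' n k : (k <= n)%N ->
  qbin n.+1 k.+1 = qbin n k.+1 + q ^+ (n - k) * qbin n k.
Proof.
move=> kn; rewrite -(@qbin_sub n.+1) ?ltnS // subSS.
have [->|kn'] := eqVneq k n; first by
  rewrite subnn expr0 mul1r [qbin n n.+1]qbin_gt // qbin0 qbinn add0r.
have -> : (n - k)%N = (n - k.+1).+1 by lia.
rewrite qbin_pascal addrC; congr (_ + _); first by rewrite qbin_sub //; lia.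
by congr (_ * _); rewrite -(qbin_sub kn); congr qbin; lia.
Qed.

(** Up to sign and normalisation a Stieltjes-Wigert polynomial; each Pascal rule gives it a
    q-difference recurrence. *)
Definition Spoly (n : nat) (x : K) := \sum_(k < n.+1) qbin n k * q ^+ (k ^ 2) *
    x ^+ k.

Lemma Spoly_stepl n x : Spoly n.+1 x = Spoly n x + x * q ^+ n.+1 * Spoly n (q *
    x).
Proof.
rewrite /Spoly [LHS]big_ord_recl /= qbin0.
under eq_bigr => i _ do rewrite /bump /= add1n qbin_pascal' -1?ltnS // !mulrDl.
rewrite big_split /= addrA; congr (_ + _).
  rewrite [RHS]big_ord_recl /= qbin0; congr (_ + _).
  by rewrite big_ord_recr /= qbin_gt // !mul0r addr0.
rewrite mulr_sumr; apply: eq_bigr => i _.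
have -> : q ^+ n.+1 = q ^+ (n - i) * q ^+ i * q.
  by rewrite -exprD subnK -1?ltnS // exprSr.
have -> : (i.+1 ^ 2 = i ^ 2 + i + i + 1)%N by lia.
by rewrite exprMn !exprD expr1 (exprSr x); ring.
Qed.

Lemma Spoly_stepr n x :
  Spoly n.+1 x = Spoly n (q * x) + x * q * Spoly n (q * q * x).
Proof.
rewrite /Spoly [LHS]big_ord_recl /= qbin0.
under eq_bigr => i _ do rewrite /bump /= add1n qbin_pascal !mulrDl.
rewrite big_split /= addrA; congr (_ + _).
  rewrite [RHS]big_ord_recl /= qbin0; congr (_ + _).
  rewrite big_ord_recr /= qbin_gt // mulr0 !mul0r addr0; apply: eq_bigr => i _.
  by rewrite exprMn; ring.
rewrite mulr_sumr; apply: eq_bigr => i _.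
have -> : (i.+1 ^ 2 = i ^ 2 + i + i + 1)%N by lia.
by rewrite !exprMn !exprD expr1 (exprSr x); ring.
Qed.

(** Using [Spoly_stepr] once and then [Spoly_stepl] leaves the arguments qx, q^2 x, q^3 x, which
    match the points qz, z and z/q of [Wpoly]. *)
Lemma Spoly_step2 n x :
  Spoly n.+2 x =
  Spoly n (q * x) + x * (q ^+ n.+2 + q) * Spoly n (q * q * x) +
  x ^+ 2 * q ^+ n.+4 * Spoly n (q * q * q * x).
Proof. by rewrite Spoly_stepr !Spoly_stepl !exprS !mulrA; ring. Qed.

(* The sum over r in Z of z^(r+1) q^(r^2+r) [2L+1, L-r], with k = L - r. *)
Definition Wpoly L z := z ^+ L.+1 * q ^+ (L * L.+1) * Spoly (2 * L + 1) (z * q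
    ^+ (2 * L + 1))^-1.

Lemma Wpoly_step L z : q != 0 -> z != 0 ->
  Wpoly L.+1 z = (1 + q ^+ (2 * L + 2)) * Wpoly L z +
  q ^+ L.+1 * (z * Wpoly L (q * z) + q / z * Wpoly L (z / q)).
Proof.
move=> q0 z0; rewrite /Wpoly.
have -> : (2 * L.+1 + 1 = (2 * L + 1).+2)%N by lia.
have -> : (2 * L + 2 = (2 * L + 1).+1)%N by lia.
rewrite Spoly_step2.
set n := (2 * L + 1)%N; set X := q ^+ n.
have X0 : X != 0 by rewrite expf_neq0.
(* The arguments become those of [Spoly] in [Wpoly] at L for the points qz, z and z/q. *)
have -> : q * (z * q ^+ n.+2)^-1 = (q * z * X)^-1.
  by rewrite !exprS -/X; field; rewrite X0 q0 z0.
have -> : q * q * (z * q ^+ n.+2)^-1 = (z * X)^-1.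
  by rewrite !exprS -/X; field; rewrite X0 q0 z0.
have -> : q * q * q * (z * q ^+ n.+2)^-1 = (z / q * X)^-1.
  by rewrite !exprS -/X; field; rewrite X0 q0 z0.
have -> : q ^+ (L.+1 * L.+2) = q ^+ (L * L.+1) * (X * q).
  by rewrite /X -exprSr -exprD; congr (_ ^+ _); rewrite /n; lia.
set s1 := Spoly _ _; set s2 := Spoly _ _; set s3 := Spoly _ _.
have -> : (z / q) ^+ L.+1 = z ^+ L.+1 / q ^+ L.+1 by rewrite expr_div_n.
have eX : X * q = q ^+ L.+1 * q ^+ L.+1.
  by rewrite -exprSr -exprD; congr (_ ^+ _); rewrite /n; lia.
have XE : X = q ^+ L.+1 * q ^+ L.+1 / q by rewrite -eX mulfK.
have e1 : q ^+ n.+1 = q * X by rewrite exprS.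
have e2 : q ^+ n.+2 = q * q * X by rewrite !exprS mulrA.
have e4 : q ^+ n.+4 = q * q * q * q * X by rewrite !exprS !mulrA.
rewrite e1 e2 e4 exprMn [z ^+ L.+2]exprS XE.
move: (q ^+ L.+1) (expf_neq0 L.+1 q0) => Y Y0.
by field; rewrite Y0 q0 z0.
Qed.

Lemma Wpoly_Tfun L z : q != 0 -> z != 0 ->
  Wpoly L z = (1 + z) * Tfun L (Gser z).
Proof.
move=> q0; elim: L z => [|L IH] z z0.
  rewrite /Wpoly /Spoly /Tfun big_ord1 big_ord_recl big_ord1 /= Gser0 !qbin0.
  rewrite /bump /= [qbin _ _]qbinn qpoch0 bin_small //.
  by field; rewrite q0 z0.
rewrite Wpoly_step // Tfun_Gser_step // -!IH // mulf_neq0 // invr_neq0 //.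
Qed.

End Finite.

(** * Rearrangements of finite sums *)

Section Sums.
Variable V : nmodType.
Implicit Type F : nat -> V.

(** With k = L - r in the bilateral sum, this pairs r with -1 - r, under which r^2 + r is
    invariant. *)
Lemma sum_fold_half F L :
  \sum_(k < (2 * L + 1).+1) F k = \sum_(r < L.+1) (F (L - r)%N + F (L + r +
      1)%N).
Proof.
rewrite (_ : (2 * L + 1).+1 = L.+1 + L.+1)%N; last by lia.
rewrite big_split_ord big_split /=; congr (_ + _).
  by rewrite (reindex_inj rev_ord_inj) /=; apply: eq_bigr => i _; rewrite subSS.
by apply: eq_bigr => i _; congr F; lia.
Qed.

Lemma sum_widen F m n :
  (m <= n)%N -> (forall j, (m <= j)%N -> F j = 0) ->
  \sum_(j < m) F j = \sum_(j < n) F j.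
Proof.
move=> mn F0; rewrite -(subnKC mn) big_split_ord /=.
by rewrite [X in _ + X]big1 ?addr0 // => i _; rewrite F0 // leq_addr.
Qed.

Lemma sum_multiples F k M : (0 < k)%N ->
  (forall i, ~~ (k %| i)%N -> F i = 0) ->
  \sum_(i < k * M) F i = \sum_(n < M) F (k * n)%N.
Proof.
case: k => // k _ F0; elim: M => [|M IH]; first by rewrite muln0 !big_ord0.
rewrite mulnSr big_split_ord /= IH [RHS]big_ord_recr /=; congr (_ + _).
rewrite big_ord_recl /= addn0 big1 ?addr0 // => i _; apply: F0.
rewrite dvdn_addr ?dvdn_mulr // /bump /= add1n gtnNdvd //.
by rewrite ltnS.
Qed.

Lemma sum_triangle (F : nat -> nat -> V) M :
  \sum_(N < M) \sum_(r < N.+1) F N r =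
  \sum_(r < M) \sum_(j < M - r) F (r + j)%N r.
Proof.
elim: M => [|M IH]; first by rewrite !big_ord0.
rewrite big_ord_recr /= IH [RHS]big_ord_recr /= subSnn big_ord1 addn0 /=.
rewrite [X in _ = X + _](eq_bigr (fun r : 'I_M =>
    \sum_(j < M - r) F (r + j)%N r + F M r)); last first.
  move=> r _; have rM : (r <= M)%N by exact: ltnW.
  by rewrite (subSn rM) big_ord_recr /= subnKC.
by rewrite big_split -addrA big_ord_recr.
Qed.

End Sums.

Lemma sum_cauchyM (K : numFieldType) (a b t : nat -> K) L :
  \sum_(N < L) t N * cauchyM a b N =
  \sum_(i < L) \sum_(j < L - i) t (i + j)%N * (a i * b j).
Proof.
under eq_bigr => N _ do rewrite mulr_sumr.
rewrite (sum_triangle (fun N i => t N * (a i * b (N - i)%N))).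
by apply: eq_bigr => i _; apply: eq_bigr => j _; rewrite addKn.
Qed.

(** As t vanishes beyond L, the triangle i + j <= L may be enlarged to a box containing it, which
    decouples the two ranges. *)
Lemma sum_cauchyM_box (K : numFieldType) (a b t : nat -> K) L A B :
  (L < A)%N -> (L < B)%N -> (forall N, (L < N)%N -> t N = 0) ->
  \sum_(N < L.+1) t N * cauchyM a b N =
  \sum_(i < A) \sum_(j < B) t (i + j)%N * (a i * b j).
Proof.
move=> LA LB t0; rewrite sum_cauchyM.
rewrite -(@sum_widen _ (fun i => \sum_(j < B) t (i + j)%N * (a i * b j)) L.+1)
    //; last first.
  by move=> i Li; rewrite big1 // => j _; rewrite t0 ?mul0r //; lia.
apply: eq_bigr => i _.
apply: (@sum_widen _ (fun j => t (i + j)%N * (a i * b j))); first by lia.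
by move=> j Lj; rewrite t0 ?mul0r //; lia.
Qed.

(** * Specialization at a primitive cube root of unity *)

Section CubeRoot.
Variables (K : numFieldType) (q w : K).
Hypothesis q_nonroot : forall n, 1 - q ^+ n.+1 != 0.
Hypothesis w_root : w ^+ 2 + w + 1 = 0.

Local Notation qf := (qpoch q q).
Local Notation q3f := (qpoch (q ^+ 3) (q ^+ 3)).

Lemma w_cube : w ^+ 3 = 1.
Proof.
have e : (w - 1) * (w ^+ 2 + w + 1) = 0 by rewrite w_root mulr0.
by apply/eqP; rewrite -subr_eq0 -e; apply/eqP; ring.
Qed.

Lemma w_neq0 : w != 0.
Proof.
by apply/eqP => w0; move/eqP: w_cube; rewrite w0 expr0n /= eq_sym oner_eq0.
Qed.

Lemma w_inv : w^-1 = w ^+ 2.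
Proof. by rewrite -[RHS]mul1r -(mulVf w_neq0) -mulrA -exprS w_cube mulr1. Qed.

Lemma w_sqr : w ^+ 2 = - w - 1.
Proof. by apply/eqP; rewrite -subr_eq0 -w_root; apply/eqP; ring. Qed.

(* Coefficients of (-q^3 y^3; q^3)_oo *)
Definition cubic n : K :=
  if (3 %| n)%N then q ^+ (3 * 'C((n %/ 3).+1, 2)) / q3f (n %/ 3) else 0.

(** Coefficient form of F(y) = (1 + q^3 y^3) F(qy). *)
Lemma cubic_rec n : (1 - q ^+ n.+3) * cubic n.+3 = q ^+ n.+3 * cubic n.
Proof.
rewrite /cubic (_ : n.+3 = n + 3)%N; last by lia.
rewrite dvdn_addl //; case: ifP => [/dvdnP[k ->]|_]; last by rewrite !mulr0.
rewrite divnDr // mulnK // divnn addn1 qpochS binS bin1 mulnDr (exprD q (3 *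
    _)).
rewrite -exprS -exprM (_ : k * 3 + 3 = 3 * k.+1)%N; last by lia.
have h3 : 1 - q ^+ (3 * k.+1) != 0 by rewrite (_ : 3 * k.+1 = (3 * k + 2).+1)%N
    //; lia.
have h : q3f k != 0.
  elim: k {h3} => [|k IH]; first by rewrite qpoch0 oner_eq0.
  rewrite qpochS mulf_neq0 // -exprS -exprM (_ : 3 * k.+1 = (3 * k + 2).+1)%N
      //; lia.
by field; rewrite h3 h.
Qed.

(** Since (1 + qy)(1 + qwy)(1 + qy/w) = 1 + q^3 y^3, both sides satisfy the same functional
    equation, and the coefficients 0, 1, 2 fix the solution. *)
Lemma cubic_cauchyM :
  cauchyM (cauchyM (qexp q q) (qexp q (q * w))) (qexp q (q / w)) = cubic.
Proof.
set F := cauchyM _ _.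
have Fstep : F = mul1X q (mul1X (q * w) (mul1X (q / w) (dilate q F))).
  rewrite {2}/F !dilate_cauchyM !qexp_dilate -(cauchyM_mul1Xr (q / w)).
  rewrite -(qexp_step q_nonroot (q / w)) -(cauchyM_mul1Xl (q * w)).
  rewrite -(cauchyM_mul1Xr (q * w)) -(qexp_step q_nonroot (q * w)).
  by rewrite -!(cauchyM_mul1Xl q) -(qexp_step q_nonroot q).
have Frec n : (1 - q ^+ n.+3) * F n.+3 = q ^+ n.+3 * F n.
  rewrite mulrBl mul1r {1}Fstep /mul1X /= /dilate w_inv.
  rewrite !exprS; have e2 := w_sqr; have e3 := w_cube.
  ring: e2 e3.
have F0 : F 0 = 1.
  by rewrite /F /cauchyM !big_ord1 /= !subn0 /qexp /= !expr0 qpoch0 ?bin0n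
      ?expr0 !mul1r invr1 ?mulr1.
have F1 : F 1%N = 0.
  apply: (mulfI (q_nonroot 0)); rewrite mulr0 mulrBl mul1r {1}Fstep /mul1X /=
      /dilate w_inv.
  by have e2 := w_sqr; ring: e2.
have F2 : F 2%N = 0.
  apply: (mulfI (q_nonroot 1)); rewrite mulr0 mulrBl mul1r {1}Fstep /mul1X /=
      /dilate w_inv.
  rewrite F1; have e2 := w_sqr; have e3 := w_cube; ring: e2 e3.
apply/funext => n.
elim/ltn_ind: n => -[|[|[|n]]] IH //.
- by rewrite F0 /cubic /= div0n qpoch0 bin_small // expr0 divr1.
- apply: (mulfI (q_nonroot n.+2)); rewrite Frec cubic_rec IH //; lia.
Qed.

End CubeRoot.

Section CubeRoot2.
Variables (K : numFieldType) (q w : K).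
Hypothesis q_nonroot : forall n, 1 - q ^+ n.+1 != 0.
Hypothesis w_root : w ^+ 2 + w + 1 = 0.

Local Notation qf := (qpoch q q).
Local Notation q3f := (qpoch (q ^+ 3) (q ^+ 3)).

(* The sequence 1, -2, 1, 1, -2, 1, ... *)
Definition wcoef r := - (w ^+ 2 * w ^+ r + w * (w ^+ 2) ^+ r).

(** The two powers are z^(r+1) at r and at -1 - r for z = w, as w^(-r) = w^(2r); [wcoef] is their
    sum freed of the factor 1 + w. *)
Lemma wcoefE r : (1 + w) * wcoef r = w ^+ r.+1 + (w ^+ 2) ^+ r.
Proof.
rewrite /wcoef (exprS w r).
by have e2 := w_sqr w_root; have e3 := w_cube w_root; ring: e2 e3.
Qed.

Lemma w_add1_neq0 : 1 + w != 0.
Proof.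
have -> : 1 + w = - w ^+ 2 by rewrite (w_sqr w_root); ring.
by rewrite oppr_eq0 expf_neq0 // (w_neq0 w_root).
Qed.

Lemma wcoef0 : wcoef 0 = 1.
Proof. by rewrite /wcoef !expr0 (w_sqr w_root); ring. Qed.

Lemma Wpoly_w L : q != 0 ->
  Wpoly q L w =
  (1 + w) * \sum_(r < L.+1) wcoef r * q ^+ (r ^ 2 + r) * qbin q (2 * L + 1) (L
      - r).
Proof.
move=> q0; have w0 := w_neq0 w_root.
pose n := (2 * L + 1)%N; have x0 : w * q ^+ n != 0 by rewrite mulf_neq0
    ?expf_neq0.
rewrite /Wpoly /Spoly.
rewrite (sum_fold_half (fun k => qbin q n k * q ^+ (k ^ 2) * (w * q ^+ n)^-1 ^+
    k)).
rewrite !mulr_sumr; apply: eq_bigr => r _.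
have rL : (r <= L)%N by rewrite -ltnS.
rewrite -(@qbin_sub _ q n (L + r + 1)%N); last by rewrite /n; lia.
have -> : (n - (L + r + 1) = L - r)%N by rewrite /n; lia.
rewrite !mulrA wcoefE !exprVn -/n.
set P := w ^+ L.+1 * _.
(* [f1] and [f2] clear the negative powers of w q^n; the remaining exponent of q is r^2 + r in both,
   and w^3 = 1 reduces the power of w in [f2]. *)
have f1 : P * q ^+ ((L - r) ^ 2) = w ^+ r.+1 * q ^+ (r ^ 2 + r) * (w * q ^+ n)
    ^+ (L - r).
  rewrite exprMn -exprM /P -mulrA -exprD mulrACA -!exprD.
  by congr (_ ^+ _ * _ ^+ _); rewrite /n; [lia|nia].
have f2 : P * q ^+ ((L + r + 1) ^ 2) =
    (w ^+ 2) ^+ r * q ^+ (r ^ 2 + r) * (w * q ^+ n) ^+ (L + r + 1).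
  rewrite [(w * _) ^+ _]exprMn -!exprM /P -mulrA -exprD mulrACA -!exprD.
  have -> : (2 * r + (L + r + 1) = 3 * r + L.+1)%N by lia.
  rewrite (exprD w (3 * r)) (exprM w 3) (w_cube w_root) expr1n mul1r.
  by congr (_ * _ ^+ _); rewrite /n; nia.
set B := qbin _ _ _.
rewrite mulrDr ![_ * (B * _ * _)]mulrA ![_ * (B * _)]mulrA ![P * B]mulrC
    -!(mulrA B) f1 f2.
by rewrite !mulfK ?expf_neq0 //; ring.
Qed.

(** Splitting 1 + y off (-y;q)_oo leaves (-qy, -wqy, -qy/w; q)_oo, the product of
    [cubic_cauchyM]. *)
Lemma GserE_cubic : Gser q w = mul1X 1 (cauchyM (cubic q) (qgeom2 q)).
Proof.
rewrite /Gser Gprod_step1 // /Gprod mul1r; congr mul1X.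
by rewrite (cubic_cauchyM q_nonroot w_root).
Qed.

(* The weights of [Tfun], extended by 0 to N > L. *)
Definition tweight L N : K := q ^+ 'C(N.+1, 2) * qf L * inv_qfact q (L%:Z -
    N%:Z).

Lemma tweight_gt L N : (L < N)%N -> tweight L N = 0.
Proof.
move=> LN; rewrite /tweight; case e : (_ - _) => [k|k] /=; last by rewrite
    mulr0.
by exfalso; move: e; lia.
Qed.

Lemma Tfun_tweight L a : Tfun q L a = \sum_(N < L.+1) tweight L N * a N.
Proof.
apply: eq_bigr => N _; rewrite /tweight.
rewrite (_ : L%:Z - N%:Z = (L - N)%N%:Z) ?mulrA //.
by have := ltn_ord N; lia.
Qed.

(** The factor 1 + y of G_w turns into the two weights at N and N + 1; they give the first and the
    second multiple sum. *)
Lemma Tfun_GserE L : Tfun q L (Gser q w) =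
  \sum_(N < L.+1) (tweight L N + tweight L N.+1) * cauchyM (cubic q) (qgeom2 q)
      N.
Proof.
rewrite Tfun_tweight GserE_cubic; set h := cauchyM _ _.
under eq_bigr => N _ do rewrite /mul1X mul1r mulrDr.
rewrite big_split /= [X in _ + X]big_ord_recl /= mulr0 add0r.
under [in RHS]eq_bigr => N _ do rewrite mulrDl.
rewrite [RHS]big_split /=; congr (_ + _).
by rewrite [RHS]big_ord_recr /= tweight_gt // mul0r addr0.
Qed.

(** The cubic series contributes only exponents 3n and 1/(y^2;q)_oo only exponents 2m, so N = 3n +
    2m; the power of q is then (N+1 choose 2) + 3 (n+1 choose 2). *)
Lemma inner_sum L M : (L < M)%N ->
  \sum_(m < M) \sum_(n < M)
   (q ^+ (2 * m ^ 2 + 6 * m * n + 6 * n ^ 2 + m + 3 * n) * qf L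
     / (qf m * q3f n) * inv_qfact q (L%:Z - (3 * n)%N%:Z - (2 * m)%N%:Z) +
    q * (q ^+ (2 * m ^ 2 + 6 * m * n + 6 * n ^ 2 + 3 * m + 6 * n) * qf L
     / (qf m * q3f n) * inv_qfact q (L%:Z - (3 * n)%N%:Z - (2 * m)%N%:Z - 1)))
  = Tfun q L (Gser q w).
Proof.
move=> LM; rewrite Tfun_GserE.
rewrite (@sum_cauchyM_box _ _ _ (fun N => tweight L N + tweight L N.+1) L (3 *
    M) (2 * M)); [|lia|lia|]; last first.
  by move=> N LN; rewrite !tweight_gt ?addr0 //; lia.
rewrite (sum_multiples (F := fun i => \sum_(j < 2 * M) (tweight L (i + j) +
    tweight L (i + j).+1) * (cubic q i * qgeom2 q j))) //; last first.
  by move=> i /negbTE i3; apply: big1 => j _; rewrite /cubic i3 mul0r mulr0.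
rewrite exchange_big /=; apply: eq_bigr => n _.
rewrite (sum_multiples (F := fun j => (tweight L (3 * n + j) + tweight L (3 * n
    + j).+1) * (cubic q (3 * n) * qgeom2 q j))) //; last first.
  by move=> i; rewrite dvdn2 negbK /qgeom2 => ->; rewrite !mulr0.
apply: eq_bigr => m _; rewrite /cubic /qgeom2 dvdn_mulr // mulKn //.
rewrite (mul2n m) odd_double doubleK -(mul2n m) /tweight.
have -> : L%:Z - (3 * n + 2 * m)%N%:Z = L%:Z - (3 * n)%N%:Z - (2 * m)%N%:Z by
    lia.
have -> : L%:Z - (3 * n + 2 * m).+1%:Z = L%:Z - (3 * n)%N%:Z - (2 * m)%N%:Z - 1
    by lia.
set i1 := inv_qfact _ _; set i2 := inv_qfact _ _.
have bin2E k : ('C(k.+1, 2) * 2 = k * k.+1)%N.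
  by elim: k => // k IH; rewrite binS bin1 mulnDl IH; lia.
have -> : (2 * m ^ 2 + 6 * m * n + 6 * n ^ 2 + m + 3 * n =
   'C((3 * n + 2 * m).+1, 2) + 3 * 'C(n.+1, 2))%N.
  by have := bin2E n; have := bin2E (3 * n + 2 * m)%N; nia.
have -> : (2 * m ^ 2 + 6 * m * n + 6 * n ^ 2 + 3 * m + 6 * n =
   'C((3 * n + 2 * m).+1, 2) + 3 * 'C(n.+1, 2) + (3 * n + 2 * m))%N.
  by have := bin2E n; have := bin2E (3 * n + 2 * m)%N; nia.
rewrite [in 'C((3 * n + 2 * m).+2, 2)]binS bin1 !exprD (exprS q (3 * n + 2 *
    m)).
rewrite !exprD invfM; ring.
Qed.

(** [Wpoly_Tfun] at z = w, divided by (1 + w) (q)_{2L+1}. *)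
Lemma beta_sum L :
  \sum_(r < L.+1) wcoef r * q ^+ (r ^ 2 + r) / (qf (L - r) * qf (L + r + 1))
  = Tfun q L (Gser q w) / qf (2 * L + 1).
Proof.
have nz := qf_neq0 q_nonroot.
(* [Wpoly] involves inverse powers of q, so q = 0 is checked directly: only r = 0 and N = 0
   survive. *)
have [q0|q0] := eqVneq q 0.
  have qf1 n : qf n = 1.
    by elim: n => [|n IH]; rewrite ?qpoch0 // qpochS IH q0 mul0r subr0 mulr1.
  rewrite /Tfun !big_ord_recl !big1 ?addr0; first last.
  - move=> i _; rewrite lift0 /= q0 expr0n addnS /=; ring.
  - by move=> i _; rewrite lift0 /= q0 expr0n binS bin1 addnS /= !mul0r.
  by rewrite /= Gser0 // wcoef0 !qf1 !expr0 !mul1r !invr1 !mulr1.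
apply: (mulfI w_add1_neq0); rewrite [RHS]mulrA -Wpoly_Tfun ?(w_neq0 w_root) //.
rewrite Wpoly_w // -mulrA; congr (_ * _); rewrite mulr_suml; apply: eq_bigr =>
    r _.
have rL : (r <= L)%N by rewrite -ltnS.
rewrite /qbin (_ : (L - r <= 2 * L + 1)%N); last by lia.
rewrite (_ : 2 * L + 1 - (L - r) = L + r + 1)%N; last by lia.
by field; rewrite !nz.
Qed.

End CubeRoot2.

(** * The Bailey chain and the finite Jacobi triple product *)

(** Iterated Bailey lemma, k steps from the sequence b. The weights are kept arbitrary because the
    same recursion serves for the absolute bounds, with geometric u and constant v. *)
Fixpoint chain (K : numFieldType) (u v b : nat -> K) (k M : nat) : K :=
  if k is k'.+1 then \sum_(L < M.+1) v (M - L)%N * (u L * chain u v b k' L)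
  else b M.

Section Bailey.
Variables (K : numFieldType) (q : K).
Hypothesis q_nonroot : forall n, 1 - q ^+ n.+1 != 0.

Local Notation qf := (qpoch q q).

(** A limiting case of the q-Vandermonde sum, by induction on n for all c; the step passes from (n +
    1, c) to (n, c + 1). *)
Lemma qvandermonde n c :
  \sum_(j < n.+1) q ^+ (j ^ 2 + c * j) / (qf (n - j) * qf j * qf (j + c)) =
  (qf n * qf (n + c))^-1.
Proof.
have nz := qf_neq0 q_nonroot.
elim: n c => [|n IH] c; first by rewrite big_ord1 /= qpoch0 muln0 expr0 !mul1r.
apply: (mulfI (q_nonroot n)).
have -> : (1 - q ^+ n.+1) * (qf n.+1 * qf (n.+1 + c))^-1 = (qf n * qf (n +
    c.+1))^-1.
  by rewrite qfS addSnnS; field; rewrite !nz q_nonroot.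
rewrite -IH mulr_sumr.
pose f j := q ^+ (j ^ 2 + c * j) / (qf (n.+1 - j) * qf j * qf (j + c)).
(* 1 - q^(n+1) = q^j (1 - q^(n+1-j)) + (1 - q^j): the first part lowers (q)_{n+1-j}, the second
   lowers (q)_j, and after shifting j in the second they recombine. *)
rewrite (eq_bigr (fun j : 'I_n.+2 => q ^+ j * (1 - q ^+ (n.+1 - j)) * f j + (1
    - q ^+ j) * f j)); last first.
  move=> j _; rewrite -mulrDl; congr (_ * _).
  by rewrite -{1}(@subnKC j n.+1) -1?ltnS // exprD; ring.
rewrite big_split /= big_ord_recr [X in _ + X]big_ord_recl /=.
rewrite subnn expr0 subrr mulr0 !mul0r addr0 add0r -big_split /=.
apply: eq_bigr => j _; rewrite /f /bump /= add1n subSS.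
have jn : (j <= n)%N by rewrite -ltnS.
rewrite (subSn jn) (addSn j c) (addnS j c) !qfS.
have -> : (j.+1 ^ 2 + c * j.+1 = j ^ 2 + c * j + j + (j + c).+1)%N by lia.
have -> : (j ^ 2 + c.+1 * j = j ^ 2 + c * j + j)%N by lia.
rewrite !(exprD q (_ + _)%N); have := q_nonroot (n - j) => h1.
have := q_nonroot (j + c) => h2; have := q_nonroot j => h3.
move: (q ^+ (j ^ 2 + c * j)) (q ^+ (j + c).+1) h2 => A B h2.
by field; rewrite !nz h1 h2 h3.
Qed.

(** Each step is the Bailey lemma for a = q with both parameters sent to infinity: with L = r + j,
    the sum over j is [qvandermonde] at n = M - r, c = 2r + 1. *)
Lemma chain_bailey (x : nat -> K) k M :
  chain (fun L => q ^+ (L ^ 2 + L)) (fun n => (qf n)^-1)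
    (fun L => \sum_(r < L.+1) x r / (qf (L - r) * qf (L + r + 1))) k M =
  \sum_(r < M.+1) x r * q ^+ (k * (r ^ 2 + r)) / (qf (M - r) * qf (M + r + 1)).
Proof.
have nz := qf_neq0 q_nonroot.
elim: k M => [|k IH] M /=.
  by apply: eq_bigr => r _; rewrite mul0n expr0 mulr1.
under eq_bigr => L _ do rewrite IH !mulr_sumr.
rewrite (sum_triangle (fun L r => (qf (M - L))^-1 * (q ^+ (L ^ 2 + L) *
  (x r * q ^+ (k * (r ^ 2 + r)) / (qf (L - r) * qf (L + r + 1)))))).
apply: eq_bigr => r _; have rM : (r <= M)%N by rewrite -ltnS.
have := qvandermonde (M - r) (2 * r + 1); rewrite (subSn rM).
have -> : (M - r + (2 * r + 1) = M + r + 1)%N by lia.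
move=> <-; rewrite mulr_sumr; apply: eq_bigr => j _.
have jM : (j <= M - r)%N by rewrite -ltnS.
rewrite addKn -subnDA (_ : r + j + r + 1 = j + (2 * r + 1))%N; last by lia.
have -> : ((r + j) ^ 2 + (r + j) = (r ^ 2 + r) + (j ^ 2 + (2 * r + 1) * j))%N
    by lia.
rewrite mulSn !(exprD q (r ^ 2 + r)%N).
by field; rewrite !nz.
Qed.

Lemma qbinomial n x :
  \prod_(i < n) (1 + x * q ^+ i) = \sum_(k < n.+1) qbin q n k * q ^+ 'C(k, 2) *
      x ^+ k.
Proof.
elim: n x => [|n IH] x; first by rewrite big_ord0 big_ord1 /= qbin0 // bin0n
    !mulr1.
rewrite big_ord_recl /= expr0 mulr1.
under eq_bigr => i _ do rewrite /bump /= add1n exprS mulrA.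
rewrite IH [RHS]big_ord_recl /= qbin0 // mulrDl mul1r.
under [in RHS]eq_bigr => i _ do rewrite /bump /= add1n qbin_pascal // !mulrDl.
rewrite [in RHS]big_split addrA /=; congr (_ + _).
  rewrite [LHS]big_ord_recl /= qbin0 // !expr0; congr (_ + _).
  rewrite [RHS]big_ord_recr /= qbin_gt // mulr0 !mul0r addr0; apply: eq_bigr =>
      i _.
  by rewrite /bump /= add1n exprMn; ring.
rewrite mulr_sumr; apply: eq_bigr => i _.
by rewrite binS bin1 exprD exprMn (exprS x); ring.
Qed.

Variable w : K.
Hypothesis w_root : w ^+ 2 + w + 1 = 0.

(** The q-binomial theorem, folded at its centre, is a finite Jacobi triple product; at w its
    factors pair up as (1 + w q^j)(1 + w^2 q^j) = 1 - q^j + q^(2j). *)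
Lemma jacobi_finite L :
  \sum_(r < L.+1) wcoef w r * q ^+ 'C(r.+1, 2) * qbin q (2 * L + 1) (L - r) =
  \prod_(k < L) (1 - q ^+ k.+1 + (q ^+ k.+1) ^+ 2).
Proof.
have [q0|q0] := eqVneq q 0.
  have qf1 n : qf n = 1.
    by elim: n => [|n IH]; rewrite ?qpoch0 // qpochS IH q0 mul0r subr0 mulr1.
  rewrite !big_ord_recl big1 ?addr0 => [|i _]; last first.
    by rewrite lift0 /= q0 expr0n binS bin1 addnS /= mulr0 mul0r.
  rewrite big1 => [|i _]; last by rewrite q0 !expr0n /=; ring.
  rewrite wcoef0 // /= /qbin (_ : (L - 0 <= 2 * L + 1)%N); last by lia.
  by rewrite !qf1 bin_small // expr0 !mulr1 divr1 mul1r.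
have w0 := w_neq0 w_root.
apply: (mulfI (w_add1_neq0 w_root)).
(* The argument 1/y = 1/(w q^L) centres the product: the factors i = L - j and i = L + j become
   partners, and i = L gives 1 + 1/w. *)
pose n := (2 * L + 1)%N; pose y := w * q ^+ L.
have y0 : y != 0 by rewrite mulf_neq0 ?expf_neq0.
transitivity (w ^+ L.+1 * q ^+ 'C(L.+1, 2) * \prod_(i < n) (1 + y^-1 * q ^+ i)).
  rewrite qbinomial (sum_fold_half (fun k => qbin q n k * q ^+ 'C(k, 2) * y^-1
      ^+ k)).
  rewrite !mulr_sumr; apply: eq_bigr => r _.
  have rL : (r <= L)%N by rewrite -ltnS.
  rewrite -(@qbin_sub _ q n (L + r + 1)%N); last by rewrite /n; lia.
  have -> : (n - (L + r + 1) = L - r)%N by rewrite /n; lia.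
  rewrite !mulrA wcoefE // !exprVn -/n.
  set P := w ^+ L.+1 * _.
  have binE k : ('C(k, 2) * 2 + k = k ^ 2)%N.
    by elim: k => // k IH; rewrite binS bin1; lia.
  have f1 : P * q ^+ 'C(L - r, 2) = w ^+ r.+1 * q ^+ 'C(r.+1, 2) * y ^+ (L - r).
    rewrite /y exprMn -exprM /P -mulrA -exprD mulrACA -!exprD.
    congr (_ ^+ _ * _ ^+ _); first by lia.
    by have := binE (L - r)%N; have := binE L.+1; have := binE r.+1; nia.
  have f2 : P * q ^+ 'C(L + r + 1, 2) =
      (w ^+ 2) ^+ r * q ^+ 'C(r.+1, 2) * y ^+ (L + r + 1).
    rewrite [y ^+ _]exprMn -!exprM /P -mulrA -exprD mulrACA -!exprD.
    have -> : (2 * r + (L + r + 1) = 3 * r + L.+1)%N by lia.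
    rewrite (exprD w (3 * r)) (exprM w 3) (w_cube w_root) expr1n mul1r.
    congr (_ * _ ^+ _).
    by have := binE (L + r + 1)%N; have := binE L.+1; have := binE r.+1; nia.
  set B := qbin _ _ _.
  rewrite [in RHS]mulrDr ![_ * (B * _ * _)]mulrA ![_ * (B * _)]mulrA ![P *
      B]mulrC -!(mulrA B) f1 f2.
  by rewrite !mulfK ?expf_neq0 //; ring.
(* Distributes the prefactor over the L lower factors, turning 1 + q^(-j)/w into 1 + w q^j. *)
have prodE : w ^+ L * q ^+ 'C(L.+1, 2) = \prod_(j < L) (w * q ^+ j.+1).
  elim: L {n y y0} => [|L IH]; first by rewrite big_ord0 bin_small // !mulr1.
  by rewrite big_ord_recr /= -IH [in LHS]binS bin1 exprD !exprS; ring.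
have lower : w ^+ L * q ^+ 'C(L.+1, 2) * \prod_(i < L) (1 + y^-1 * q ^+ i) =
   \prod_(j < L) (1 + w * q ^+ j.+1).
  rewrite prodE [X in _ * X](reindex_inj rev_ord_inj) -big_split /=.
  apply: eq_bigr => j _; rewrite /y.
  have -> : q ^+ L = q ^+ j.+1 * q ^+ (L - j.+1) by rewrite -exprD subnKC.
  by field; rewrite !expf_neq0 //.
rewrite (_ : n = L + L.+1)%N; last by rewrite /n; lia.
rewrite big_split_ord /= exprS [LHS]mulrA -!(mulrA w) lower.
rewrite big_ord_recl /= addn0.
have -> : y^-1 * q ^+ L = w^-1 by rewrite /y; field; rewrite w0 expf_neq0.
rewrite [LHS](_ : _ = (w * (1 + w^-1)) * (\prod_(j < L) (1 + w * q ^+ j.+1) *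
   \prod_(i < L) (1 + y^-1 * q ^+ (L + bump 0 i)))); last by ring.
rewrite mulrDr divff // mulr1 [w + 1]addrC; congr (_ * _).
rewrite -big_split /=; apply: eq_bigr => i _.
rewrite /bump /= add1n exprD mulrA.
have -> : y^-1 * q ^+ L = w^-1 by rewrite /y; field; rewrite w0 expf_neq0.
by rewrite (w_inv w_root); have e2 := w_sqr w_root; have e3 := w_cube w_root;
    ring: e2 e3.
Qed.

End Bailey.

(** * Limits in the complex numbers *)

(* [R[i]] carries its topology only as a numFieldType. *)
Definition complexNF (R : realType) : numFieldType := R[i].

Section ComplexLimits.
Variable R : realType.
Local Notation C := (complexNF R).
Implicit Types z l : C.

Lemma normr_normc z : `|z| = (normc z)%:C%C.
Proof. by []. Qed.

Lemma normc_ge0 z : 0 <= normc z.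
Proof. by case: z => a b; rewrite /normc sqrtr_ge0. Qed.

Lemma ler_normcD z z' : normc (z + z') <= normc z + normc z'.
Proof. by rewrite -lecR rmorphD; exact: (@ler_normD _ R[i]). Qed.

Lemma normcNE z : normc (- z) = normc z.
Proof. exact: (normcN (z : Rcomplex R)). Qed.

Lemma normcX z n : normc (z ^+ n) = normc z ^+ n.
Proof.
by elim: n => [|n IH]; [exact: normc1 | rewrite !exprS normcM IH].
Qed.

Lemma ler_normc_sum (I : Type) (r : seq I) (P : pred I) (F : I -> C) :
  normc (\sum_(i <- r | P i) F i) <= \sum_(i <- r | P i) normc (F i).
Proof.
apply: (big_ind2 (fun (x : C) y => normc x <= y)) => //; first by rewrite
    normc0.
by move=> x1 x2 y1 y2 h1 h2; apply: (le_trans (ler_normcD _ _)); exact: lerD.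
Qed.

Lemma normc_prod (I : Type) (r : seq I) (P : pred I) (F : I -> C) :
  normc (\prod_(i <- r | P i) F i) = \prod_(i <- r | P i) normc (F i).
Proof. by apply: big_morph; [exact: normcM | exact: normc1]. Qed.

Lemma ler_Re_normc z : `|complex.Re z| <= normc z.
Proof.
case: z => a b /=; rewrite -sqrtr_sqr ler_wsqrtr // lerDl; exact: sqr_ge0.
Qed.

Lemma ler_Im_normc z : `|complex.Im z| <= normc z.
Proof.
case: z => a b /=; rewrite -sqrtr_sqr ler_wsqrtr // lerDr; exact: sqr_ge0.
Qed.

Lemma ler_normc_ReIm z : normc z <= `|complex.Re z| + `|complex.Im z|.
Proof.
case: z => a b /=; have := normr_ge0 a; have := normr_ge0 b => hb ha.
rewrite -[leRHS]ger0_norm ?addr_ge0 // -sqrtr_sqr ler_wsqrtr // sqrrD.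
by rewrite !real_normK ?num_real // -addrA [X in _ <= _ + X]addrC addrA lerDl
    mulrn_wge0 // mulr_ge0.
Qed.

(** Passes from the norm of [C], whose values lie in [C] itself, to the real modulus. *)
Lemma cvgcP (T : Type) (F : set_system T) (FF : Filter F) (u : T -> C) l :
  u @ F --> l <-> (normc (l - u t) @[t --> F] --> (0 : R)).
Proof.
split=> [/cvgrPdist_lt h|/cvgrPdist_lt h]; apply/cvgrPdist_lt => e e0.
  have /h : 0 < e%:C%C :> C by rewrite (ltcR 0).
  apply: filterS => t; rewrite normr_normc ltcR sub0r normrN ger0_norm //.
  exact: normc_ge0.
(* A positive element of [C] is real. *)
have eR : e = (complex.Re e)%:C%C by rewrite RRe_real // gtr0_real.
move: e0; rewrite eR (ltcR 0) => /h; apply: filterS => t.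
by rewrite sub0r normrN ger0_norm ?normc_ge0 // normr_normc ltcR.
Qed.

(** The sequence is its first term plus a telescoping series that converges absolutely. *)
Lemma real_cvg_increments (s d : nat -> R) (B : R) :
  (forall n, `|s n.+1 - s n| <= d n) -> (forall n, \sum_(k < n) d k <= B) ->
  cvg (s @ \oo).
Proof.
move=> hs hB; pose u n := s n.+1 - s n.
have cu : cvgn (series u).
  apply: normed_cvg; apply: nondecreasing_is_cvgn.
    by apply: nondecreasing_series => n _ _; exact: normr_ge0.
  exists B => _ [n _ <-]; apply: le_trans (hB n).
  by rewrite /= seriesEord; apply: ler_sum => i _; exact: hs.
have -> : s = (fun n => s 0%N + series u n).
  by apply/funext => n; rewrite seriesEnat /= telescope_sumr //; ring.
by apply: is_cvgD => //; exact: is_cvg_cst.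
Qed.

Lemma complex_cvg_increments (s : nat -> C) (d : nat -> R) (B : R) :
  (forall n, normc (s n.+1 - s n) <= d n) -> (forall n, \sum_(k < n) d k <= B)
      ->
  cvg (s @ \oo).
Proof.
move=> hs hB.
have cR : cvg ((complex.Re (s n)) @[n --> \oo]).
  apply: (@real_cvg_increments _ d B) => // n; apply: le_trans (hs n).
  apply: le_trans (ler_Re_normc _); rewrite le_eqVlt; apply/orP; left;
      apply/eqP.
  by case: (s n.+1) (s n) => a b [c e].
have cI : cvg ((complex.Im (s n)) @[n --> \oo]).
  apply: (@real_cvg_increments _ d B) => // n; apply: le_trans (hs n).
  apply: le_trans (ler_Im_normc _); rewrite le_eqVlt; apply/orP; left;
      apply/eqP.
  by case: (s n.+1) (s n) => a b [c e].
move: cR cI => /cvg_ex[a ha] /cvg_ex[b hb].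
apply/cvg_ex; exists (Complex a b); apply/cvgcP.
apply: (@squeeze_cvgr _ _ _ _ (fun=> 0) (fun n => `|a - complex.Re (s n)| + `|b
    - complex.Im (s n)|)).
- apply: nearW => n; rewrite normc_ge0 /=; apply: le_trans (ler_normc_ReIm _) _.
  by case: (s n).
- exact: cvg_cst.
- rewrite -[0 in X in _ --> X](addr0 0); apply: cvgD.
    rewrite -[0 in X in _ --> X](normr0 R) -(subrr a); apply: cvg_norm.
    by apply: cvgB => //; exact: cvg_cst.
  rewrite -[0 in X in _ --> X](normr0 R) -(subrr b); apply: cvg_norm.
  by apply: cvgB => //; exact: cvg_cst.
Qed.

Lemma geometric_sum_le (r : R) n : 0 <= r -> r < 1 -> \sum_(k < n) r ^+ k <= (1
    - r)^-1.
Proof.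
move=> r0 r1; have h : 0 < 1 - r by rewrite subr_gt0.
rewrite -(ler_pM2l h) divff ?gt_eqF // -[1 - r]opprB mulNr -subrX1 opprB.
by rewrite gerBl exprn_ge0.
Qed.

End ComplexLimits.

(** * Unconditional sums along an exhaustion by finite sets *)

Section FsetSums.
Variable I : choiceType.
Implicit Types A B : {fset I}.

Lemma sum_fsetD (V : nmodType) A B (F : I -> V) : (A `<=` B)%fset ->
  \sum_(i <- B) F i = \sum_(i <- A) F i + \sum_(i <- (B `\` A)%fset) F i.
Proof.
move=> AB; rewrite (big_fsetID _ (mem A) B) /=; congr (_ + _); apply: eq_fbigl
    => i.
  by rewrite !inE /= andbC; case: (boolP (i \in A)) => // /(fsubsetP AB) ->.
by rewrite !inE /= andbC.
Qed.

Lemma ler_sum_fset (R : numDomainType) A B (F : I -> R) :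
  (A `<=` B)%fset -> (forall i, 0 <= F i) -> \sum_(i <- A) F i <= \sum_(i <- B)
      F i.
Proof.
by move=> AB F0; rewrite (sum_fsetD _ AB) lerDl sumr_ge0.
Qed.

End FsetSums.

Section Unconditional.
Variables (R : realType) (I : choiceType).
Local Notation C := (complexNF R).
Variables (x : I -> C) (A : nat -> {fset I}) (B : R).
Hypothesis A_nd : forall n, (A n `<=` A n.+1)%fset.
Hypothesis A_exhaust : forall i, exists n, i \in A n.
Hypothesis A_bounded : forall n, \sum_(i <- A n) normc (x i) <= B.

Let S n := \sum_(i <- A n) x i.
Let D n := \sum_(i <- A n) normc (x i).

Lemma exhaust_le m n : (m <= n)%N -> (A m `<=` A n)%fset.
Proof.
move=> /subnKC <-; elim: (n - m)%N => [|k IH]; first by rewrite addn0.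
by rewrite addnS; exact: fsubset_trans IH _.
Qed.

Lemma exhaust_fset (J : {fset I}) n : exists m, (n <= m)%N /\ (J `<=` A m)%fset.
Proof.
suff [m [nm h]] : exists m, (n <= m)%N /\ forall i, i \in (J : seq I) -> i \in
    A m.
  by exists m; split => //; apply/fsubsetP.
elim: (J : seq I) => [|i s [m [nm h]]]; first by exists n.
have [k ik] := A_exhaust i; exists (maxn m k); split; first by rewrite leq_max
    nm.
move=> j; rewrite inE => /orP[/eqP ->|/h jm].
  by apply: (fsubsetP (exhaust_le _)) ik; rewrite leq_maxr.
by apply: (fsubsetP (exhaust_le _)) jm; rewrite leq_maxl.
Qed.

(** The sums [D] of the moduli are monotone and bounded, hence convergent; they control both the
    increments of [S] and the sum over any finite set outside [A n]. *)
Lemma uncond_sum_exhaust :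
  uncond_summable x /\ (S n @[n --> \oo] --> uncond_sum x).
Proof.
have cS : cvg (S n @[n --> \oo]).
  apply: (@complex_cvg_increments _ _ (fun n => D n.+1 - D n) B) => n.
    rewrite /S /D !(sum_fsetD _ (A_nd n)) ![_ + _ - _]addrAC !subrr !add0r.
    exact: ler_normc_sum.
  rewrite -(big_mkord xpredT (fun k => D k.+1 - D k)) telescope_sumr //.
  rewrite lerBlDr; apply: le_trans (A_bounded n) _; rewrite lerDl sumr_ge0 //
      => i _.
  exact: normc_ge0.
have cD : cvg (D n @[n --> \oo]).
  apply: nondecreasing_is_cvgn; last by exists B => _ [n _ <-]; exact:
      A_bounded.
  by move=> m n /exhaust_le mn; apply: ler_sum_fset => // i; exact: normc_ge0.
have DlimD m n : (m <= n)%N -> D n - D m <= lim (D n @[n --> \oo]) - D m.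
  move=> mn; rewrite lerD2r; apply: nondecreasing_cvgn_le => //.
  by move=> i j /exhaust_le ij; apply: ler_sum_fset => // k; exact: normc_ge0.
pose l := lim (S n @[n --> \oo]).
have Fi := @summability.totally_filter I.
have hl : summability.partial_sum x J @[J --> summability.totally] --> l.
  apply/(cvgcP _); apply/cvgrPdist_lt => e e0.
  have e2 : 0 < e / 2 by rewrite divr_gt0.
  move/cvgcP : (cS) => /cvgrPdist_lt /(_ _ e2) hS.
  move/cvgrPdist_lt : (cD) => /(_ _ e2) hD.
  (* At this n, [S n] is within e/2 of its limit and [D n] within e/2 of its own. *)
  have [n [/= hSn hDn]] := filter_ex (filterI hS hD).
  exists (A n) => // J /= AJ.
  have [m [nm Jm]] := exhaust_fset J n.
  rewrite sub0r normrN ger0_norm ?normc_ge0 //.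
  rewrite /summability.partial_sum -(big_seq_fsetE _ _ xpredT) /= (sum_fsetD _
      AJ) -/(S n).
  rewrite opprD addrA; apply: le_lt_trans (ler_normcD _ _) _.
  rewrite normcNE [e]splitr; apply: ltr_leD.
    by move: hSn; rewrite sub0r normrN ger0_norm ?normc_ge0.
  apply: le_trans (ler_normc_sum _ _ _) _.
  (* J lies inside [A m], so its terms outside [A n] are among those counted by D m - D n. *)
  apply: (@le_trans _ _ (D m - D n)).
    rewrite /D (sum_fsetD _ (exhaust_le nm)) addrAC subrr add0r.
    apply: ler_sum_fset => [|i]; last exact: normc_ge0.
    exact: fsetSD.
  apply: le_trans (DlimD _ _ nm) _; apply: le_trans (ler_norm _) _; exact: ltW.
split; first by apply/cvg_ex; exists l.
by rewrite /uncond_sum (cvg_lim (@norm_hausdorff _ _) hl).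
Qed.

End Unconditional.

(** * Bounds and convergence of q-shifted factorials *)

Section Products.
Variable R : realType.
Local Notation C := (complexNF R).

(** For 0 <= x <= a one has 1 - x >= exp(-x/(1 - a)); the exponents then add up to a geometric
    series. *)
Lemma prod_1B_lower (a r : R) n : 0 <= a < 1 -> 0 <= r < 1 ->
  expR (- (a / ((1 - a) * (1 - r)))) <= \prod_(k < n) (1 - a * r ^+ k).
Proof.
move=> /andP[a0 a1] /andP[r0 r1].
apply: (@le_trans _ _ (expR (- (a / (1 - a) * \sum_(k < n) r ^+ k)))).
  rewrite ler_expR lerN2 invfM mulrA; apply: ler_wpM2l (geometric_sum_le _ r0
      r1).
  by rewrite divr_ge0 // subr_ge0 ltW.
elim: n => [|n IH]; first by rewrite !big_ord0 mulr0 oppr0 expR0.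
rewrite !big_ord_recr /= mulrDr opprD expRD ler_pM ?expR_ge0 //.
have rn0 : 0 <= r ^+ n by rewrite exprn_ge0.
have xa : a * r ^+ n <= a by rewrite ler_piMr // exprn_ile1 // ltW.
rewrite mulrAC; move: (a * r ^+ n) (mulr_ge0 a0 rn0) xa => x x0 xa.
have a1' : 0 < 1 - a by rewrite subr_gt0.
have x1 : 0 < 1 - x by rewrite subr_gt0 (le_lt_trans xa).
(* By e^t >= 1 + t at t = x/(1 - a), it is enough that (1 + t)(1 - x) >= 1; the difference is x (a -
   x)/(1 - a). *)
have h := expR_ge1Dx (x / (1 - a)).
rewrite expRN -[leRHS]invrK lef_pV2 ?posrE ?invr_gt0 ?expR_gt0 //.
apply: le_trans h; rewrite -div1r ler_pdivrMr // mulrDl mul1r.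
rewrite -subr_ge0 (_ : _ - _ = x / (1 - a) * (a - x)); last by field; rewrite
    gt_eqF.
by rewrite mulr_ge0 ?divr_ge0 ?subr_ge0 // ltW.
Qed.

Lemma qpoch_upper (a p : C) n : normc p < 1 ->
  normc (qpoch a p n) <= expR (normc a / (1 - normc p)).
Proof.
move=> p1; have p0 := normc_ge0 p.
apply: (@le_trans _ _ (expR (normc a * \sum_(k < n) normc p ^+ k))); last first.
  by rewrite ler_expR ler_wpM2l ?normc_ge0 ?geometric_sum_le.
elim: n => [|n IH]; first by rewrite qpoch0 big_ord0 mulr0 expR0 normc1.
rewrite qpochS normcM big_ord_recr /= mulrDr expRD ler_pM ?normc_ge0 //.
apply: le_trans (ler_normcD _ _) _; rewrite normcNE normcM normcX normc1.
exact: expR_ge1Dx.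
Qed.

Lemma qpoch_lower (a p : C) n : normc a < 1 -> normc p < 1 ->
  expR (- (normc a / ((1 - normc a) * (1 - normc p)))) <= normc (qpoch a p n).
Proof.
move=> a1 p1; apply: le_trans (@prod_1B_lower _ _ n _ _) _; rewrite ?normc_ge0
    //.
rewrite /qpoch normc_prod; apply: ler_prod => k _; rewrite -normcX -normcM.
have := ler_normcD (1 - a * p ^+ k) (a * p ^+ k); rewrite subrK normc1 => h.
rewrite lerBlDr h andbT subr_ge0 normcM normcX.
apply: mulr_ile1; rewrite ?exprn_ge0 ?normc_ge0 //; first exact: ltW.
by rewrite exprn_ile1 ?normc_ge0 // ltW.
Qed.

Lemma cvg_qpoch (a p : C) : normc p < 1 ->
  qpoch a p n @[n --> \oo] --> qpoch_inf a p.
Proof.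
move=> p1; pose B := expR (normc a / (1 - normc p)).
apply: (@complex_cvg_increments _ _ (fun n => B * normc a * normc p ^+ n) (B *
    normc a * (1 - normc p)^-1)) => n.
  rewrite qpochS mulrBr mulr1 addrAC subrr add0r normcNE !normcM normcX mulrA.
  by rewrite !ler_wpM2r ?exprn_ge0 ?normc_ge0 ?qpoch_upper.
rewrite -mulr_sumr ler_wpM2l ?mulr_ge0 ?expR_ge0 ?normc_ge0 //.
by rewrite geometric_sum_le ?normc_ge0.
Qed.

(** [qpoch_lower] keeps the partial products away from 0 uniformly in n, which excludes the limit
    0. *)
Lemma qpoch_inf_neq0 (a p : C) : normc a < 1 -> normc p < 1 -> qpoch_inf a p !=
    0.
Proof.
move=> a1 p1; apply/eqP => h0; have := @cvg_qpoch a p p1; rewrite h0 => /cvgcP.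
move/cvgrPdist_lt => /(_ _ (expR_gt0 (- (normc a / ((1 - normc a) * (1 - normc
    p)))))).
move=> /filter_ex[n]; rewrite !sub0r normrN normcNE ger0_norm ?normc_ge0 //.
by rewrite ltNge qpoch_lower.
Qed.

End Products.

(** * Tannery's theorem *)

Section Tannery.
Variable R : realType.
Local Notation C := (complexNF R).

(** For fixed K the first K terms tend to 0 with M, and the rest is at most B r^K/(1 - r) uniformly
    in M. *)
Lemma tannery_real (r B : R) (d : nat -> nat -> R) : 0 <= r < 1 ->
  (forall M k, 0 <= d M k <= B) -> (forall k, d M k @[M --> \oo] --> (0 : R)) ->
  \sum_(k < M.+1) r ^+ k * d M k @[M --> \oo] --> (0 : R).
Proof.
move=> /andP[r0 r1] dB d0.
have t0 M k : 0 <= r ^+ k * d M k.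
  by rewrite mulr_ge0 ?exprn_ge0 //; case/andP: (dB M k).
have B0 : 0 <= B by case/andP: (dB 0 0)%N => /le_trans; exact.
have r1' : 0 < 1 - r by rewrite subr_gt0.
have bound K M : \sum_(k < M.+1) r ^+ k * d M k <=
    \sum_(k < K) r ^+ k * d M k + B / (1 - r) * r ^+ K.
  (* Lengthening the sum to K + M + 1 terms allows a split at K without comparing K with M. *)
  apply: (@le_trans _ _ (\sum_(k < K + M.+1) r ^+ k * d M k)).
    by rewrite addnC [leRHS]big_split_ord /= lerDl sumr_ge0.
  rewrite big_split_ord /= lerD2l.
  apply: (@le_trans _ _ (\sum_(k < M.+1) B * r ^+ K * r ^+ k)).
    apply: ler_sum => k _; rewrite exprD mulrC -mulrA.
    by rewrite ler_wpM2r ?mulr_ge0 ?exprn_ge0 //; case/andP: (dB M (K + k)%N).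
  rewrite -mulr_sumr [leRHS]mulrAC.
  by rewrite ler_wpM2l ?mulr_ge0 ?exprn_ge0 ?geometric_sum_le.
have head K : \sum_(k < K) r ^+ k * d M k @[M --> \oo] --> (0 : R).
  elim: K => [|K IH].
    under eq_fun do rewrite big_ord0; exact: cvg_cst.
  under eq_fun do rewrite big_ord_recr /=.
  have := cvgD IH (cvgM (cvg_cst (r ^+ K)) (d0 K)); rewrite mulr0 addr0; exact.
apply/cvgrPdist_lt => e e0; have e2 : 0 < e / 2 by rewrite divr_gt0.
have /cvgrPdist_lt /(_ _ e2) /filter_ex[K hK] :
    (B / (1 - r) * r ^+ K @[K --> \oo] --> (0 : R)).
  have := cvgM (cvg_cst (B / (1 - r))) (@cvg_expr R r _); rewrite mulr0; apply.
  by rewrite ger0_norm.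
move: (head K) => /cvgrPdist_lt /(_ _ e2); apply: filterS => M.
rewrite !sub0r !normrN !ger0_norm ?sumr_ge0 // => hM.
apply: le_lt_trans (bound K M) _; rewrite [e]splitr ltrD //.
by move: hK; rewrite sub0r normrN; apply: le_lt_trans; exact: ler_norm.
Qed.

(** Stated as a difference tending to 0, so that the limit of the plain sums can be deduced from
    that of the weighted ones. *)
Lemma tannery (x : nat -> C) (w : nat -> nat -> C) (w0 : C) (r Bx B : R) :
  0 <= r < 1 -> (forall k, normc (x k) <= Bx * r ^+ k) ->
  (forall M k, normc (w M k) <= B) ->
  (forall k, w M k @[M --> \oo] --> w0) ->
  (\sum_(k < M.+1) x k * w M k - w0 * \sum_(k < M.+1) x k) @[M --> \oo] --> (0
      : C).
Proof.
move=> r01 hx hw wcv; apply/cvgcP.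
pose d M k := normc (w0 - w M k).
have Bx0 : 0 <= Bx by have := hx 0%N; rewrite expr0 mulr1; exact: le_trans
    (normc_ge0 _).
have h : \sum_(k < M.+1) r ^+ k * d M k @[M --> \oo] --> (0 : R).
  apply: (@tannery_real r (normc w0 + B)) => // [M k|k]; last exact/cvgcP.
  rewrite /d normc_ge0 /=; apply: le_trans (ler_normcD _ _) _.
  by rewrite normcNE lerD2l.
apply: (@squeeze_cvgr _ _ _ _ (fun=> 0)
   (fun M => Bx * \sum_(k < M.+1) r ^+ k * d M k)); last first.
- by have := cvgM (cvg_cst Bx) h; rewrite mulr0; exact.
- exact: cvg_cst.
apply: nearW => M; rewrite normc_ge0 /= sub0r normcNE mulr_sumr -sumrB
    mulr_sumr.
apply: le_trans (ler_normc_sum _ _ _) _; apply: ler_sum => k _.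
rewrite [w0 * _]mulrC -mulrBr normcM mulrA /d -opprB normcNE.
by rewrite ler_wpM2r ?normc_ge0.
Qed.

End Tannery.

(** * Exhausting the index set *)

(* The lists n_1, ..., n_f of sum M; L is the sum of the tail. *)
Fixpoint comps (f M : nat) : seq (seq nat) :=
  if f is f'.+1
  then [seq (M - L)%N :: s | L <- iota 0 M.+1, s <- comps f' L]
  else if M == 0%N then [:: [::]] else [::].

Lemma compsS f M :
  comps f.+1 M = [seq (M - L)%N :: s | L <- iota 0 M.+1, s <- comps f L].
Proof. by []. Qed.

Lemma mem_comps f M s : (s \in comps f M) = (size s == f) && (sumn s == M).
Proof.
elim: f M s => [|f IH] M s.
  case: M => [|M]; first by rewrite inE; case: s.
  by rewrite in_nil; case: s.
rewrite compsS; apply/allpairsPdep/idP => [[L [t [hL]]]|].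
  move: hL; rewrite mem_iota add0n ltnS IH => /andP[_ LM] /andP[/eqP <- /eqP
      tL] ->.
  by rewrite /= eqxx tL subnK /=.
case: s => // n t /andP[/eqP[tf] /eqP /= e].
have hL : sumn t \in iota 0 M.+1 by rewrite mem_iota add0n ltnS -e leq_addl.
exists (sumn t), t; split; first exact: hL.
- by rewrite IH tf !eqxx.
- by rewrite -e addnK.
Qed.

Lemma uniq_comps f M : uniq (comps f M).
Proof.
elim: f M => [|f IH] M; first by case: M.
apply: allpairs_uniq_dep => [|L _|]; [exact: iota_uniq|exact: IH|].
move=> p p' /allpairsPdep[L [s [_ hs ->]]] /allpairsPdep[L' [s' [_ hs' ->]]] /=.
case=> _ ss'; move: hs hs'; rewrite !mem_comps ss' => /andP[_ /eqP e] /andP[_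
    /eqP e'].
by rewrite -e -e'.
Qed.

Section Weights.
Variable K : numFieldType.
Implicit Types (u v b : nat -> K) (s : seq nat).

(* The product of the u(N_i), i <= f, and of the v(n_i), i < f. *)
Fixpoint wgt u v s : K :=
  if s is n :: s' then
    if s' is [::] then u n else u (n + sumn s')%N * v n * wgt u v s'
  else 1.

Lemma wgt_cons u v n s : s != [::] ->
  wgt u v (n :: s) = u (n + sumn s)%N * v n * wgt u v s.
Proof. by case: s. Qed.

(** A list of sum M whose tail has sum L begins with M - L, so summing over L is one step of
    [chain]; the last entry carries b and no v. *)
Lemma sum_comps u v b f M :
  \sum_(s <- comps f.+1 M) wgt u v s * b (last 0%N s) = u M * chain u v b f M.
Proof.
elim: f M => [|f IH] M.
  rewrite compsS big_allpairs_dep [iota _ _]/= big_cons big_seq1 /= subn0.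
  rewrite big1_seq ?addr0 // => L; rewrite mem_iota => /andP[_ /andP[L0 _]].
  by case: L L0 => // L _; rewrite big_nil.
rewrite compsS big_allpairs_dep -[iota _ _]/(index_iota 0 M.+1) big_mkord.
rewrite [chain _ _ _ _ _]/= mulr_sumr; apply: eq_bigr => L _; rewrite -IH
    !mulr_sumr.
apply: eq_big_seq => s; rewrite mem_comps => /andP[/eqP sf /eqP sL].
have LM : (L <= M)%N by rewrite -ltnS.
case: s sf sL => // m s sf sL; rewrite wgt_cons // sL subnK // [last _ _]/=;
    ring.
Qed.

Lemma sumn_dropE s i : (\sum_(i <= j < size s) nth 0 s j)%N = sumn (drop i s).
Proof.
elim: s i => [|n s IH] i; first by rewrite big_geq.
case: i => [|i] /=; last by rewrite big_add1 /= IH.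
by rewrite big_ltn // big_add1 /= IH drop0.
Qed.

Lemma wgtE u v s : s != [::] ->
  \prod_(0 <= i < size s) u (sumn (drop i s)) *
  \prod_(0 <= i < (size s).-1) v (nth 0%N s i) = wgt u v s.
Proof.
elim: s => // n [|m s] IH _.
  by rewrite /= big_nat1 big_geq //= addn0 mulr1.
rewrite wgt_cons // -IH // [size _]/= [X in _ * X]big_ltn // big_ltn //
    !big_add1.
by rewrite /=; ring.
Qed.

Lemma wgt_prod u v f (t : f.+1.-tuple nat) :
  \prod_(1 <= i < f.+2) u (Npart t i) * \prod_(1 <= i < f.+1) v (npart t i) =
  wgt u v t.
Proof.
rewrite -wgtE -?size_eq0 size_tuple // !big_add1 /=; congr (_ * _).
apply: eq_bigr => i _; rewrite /Npart big_add1 /= -sumn_dropE size_tuple.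
by [].
Qed.

End Weights.

Section Bounds.
Variable R : realType.
Local Notation C := (complexNF R).

Lemma wgt_bound (u v : nat -> C) (r c : R) s : 0 <= r -> 0 <= c ->
  (forall n, normc (u n) <= r ^+ n) -> (forall n, normc (v n) <= c) ->
  normc (wgt u v s) <= wgt (fun n => r ^+ n) (fun=> c) s.
Proof.
move=> r0 c0 hu hv; elim: s => [|n s IH]; first by rewrite normc1.
have [->|s0] := eqVneq s [::]; first exact: hu.
by rewrite !wgt_cons // !normcM !ler_pM ?mulr_ge0 ?normc_ge0.
Qed.

(** Every step multiplies the bound by c times a geometric sum, that is by at most c/(1 - r). *)
Lemma chain_bound (r c b : R) k M : 0 <= r < 1 -> 0 <= c -> 0 <= b ->
  0 <= chain (fun n => r ^+ n) (fun=> c) (fun=> b) k M <= b * (c / (1 - r)) ^+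
      k.
Proof.
move=> /andP[r0 r1] c0 b0; have r1' : 0 <= 1 - r by rewrite subr_ge0 ltW.
have D0 : 0 <= b * (c / (1 - r)) ^+ k by rewrite mulr_ge0 ?exprn_ge0 ?divr_ge0.
elim: k M {D0} => [|k IH] M; first by rewrite /= expr0 mulr1 b0 lexx.
have D0 : 0 <= b * (c / (1 - r)) ^+ k by rewrite mulr_ge0 ?exprn_ge0 ?divr_ge0.
rewrite [chain _ _ _ _ _]/=; apply/andP; split.
  apply: sumr_ge0 => L _; rewrite !mulr_ge0 ?exprn_ge0 //.
  by case/andP: (IH L).
apply: (@le_trans _ _ (\sum_(L < M.+1) c * (b * (c / (1 - r)) ^+ k) * r ^+ L)).
  apply: ler_sum => L _; rewrite -mulrA ler_wpM2l // mulrC ler_wpM2r ?exprn_ge0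
      //.
  by case/andP: (IH L).
rewrite -mulr_sumr exprS.
rewrite [leRHS](_ : _ = c * (b * (c / (1 - r)) ^+ k) * (1 - r)^-1); last by
    ring.
by rewrite ler_wpM2l ?geometric_sum_le // mulr_ge0.
Qed.

Lemma qpoch_bounds (p : C) : normc p < 1 ->
  exists c : R, [/\ 0 <= c, forall n, normc (qpoch p p n) <= c &
                    forall n, normc (qpoch p p n)^-1 <= c].
Proof.
move=> p1; pose c1 := expR (normc p / (1 - normc p)).
pose d := expR (- (normc p / ((1 - normc p) * (1 - normc p)))).
exists (c1 + d^-1); have c10 : 0 <= c1 := expR_ge0 _.
have d0 : 0 < d by exact: expR_gt0.
have di : 0 <= d^-1 by rewrite invr_ge0 ltW.
split=> [|n|n]; first exact: addr_ge0.
  by apply: le_trans (qpoch_upper _ _ p1) _; rewrite lerDl.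
have h := qpoch_lower n p1 p1; rewrite -/d in h.
rewrite normcV; apply: (@le_trans _ _ d^-1); last by rewrite lerDr.
by rewrite lef_pV2 ?posrE // (lt_le_trans d0 h).
Qed.

End Bounds.

Section IndexSets.
Variable f : nat.

(** The default zero tuple of [insubd] is never reached, since the lists in [comps f L] have size
    f. *)
Definition tuples_le (M : nat) : seq (f.-tuple nat) :=
  [seq insubd (nseq_tuple f 0%N) s | s <- [seq s | L <- iota 0 M.+1, s <- comps
      f L]].

Lemma mem_lists_le M s :
  (s \in [seq s | L <- iota 0 M.+1, s <- comps f L]) = (size s == f) && (sumn s
      <= M)%N.
Proof.
apply/allpairsPdep/idP => [[L [t [hL]]]|/andP[sf sM]].
  by move: hL; rewrite mem_iota mem_comps => /andP[_ LM] /andP[tf /eqP tL] ->;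
      rewrite tf tL.
have hL : sumn s \in iota 0 M.+1 by rewrite mem_iota.
by exists (sumn s), s; split; rewrite ?mem_comps ?sf ?eqxx.
Qed.

Lemma mem_tuples_le M t : (t \in tuples_le M) = (sumn t <= M)%N.
Proof.
apply/mapP/idP => [[s]|tM].
  rewrite mem_lists_le => /andP[sf sM] ->; rewrite val_insubd sf //.
by exists (val t); [rewrite mem_lists_le size_tuple eqxx | rewrite valKd].
Qed.

Lemma uniq_tuples_le M : uniq (tuples_le M).
Proof.
rewrite map_inj_in_uniq; last first.
  move=> s s'; rewrite !mem_lists_le => /andP[sf _] /andP[s'f _] /(congr1 val).
  by rewrite !val_insubd sf s'f.
apply: allpairs_uniq_dep => [|L _|]; [exact: iota_uniq|exact: uniq_comps|].
move=> p p' /allpairsPdep[L [s [_ hs ->]]] /allpairsPdep[L' [s' [_ hs' ->]]] /=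
    ss'.
move: hs hs'; rewrite !mem_comps ss' => /andP[_ /eqP e] /andP[_ /eqP e'].
by rewrite -e -e'.
Qed.

Lemma sum_tuples_le (V : nmodType) M (F : seq nat -> V) :
  \sum_(t <- tuples_le M) F (val t) = \sum_(L < M.+1) \sum_(s <- comps f L) F s.
Proof.
rewrite big_map big_allpairs_dep -[iota _ _]/(index_iota 0 M.+1) big_mkord.
apply: eq_bigr => L _; apply: eq_big_seq => s; rewrite mem_comps => /andP[sf _].
by rewrite val_insubd sf.
Qed.

Definition index_list (M : nat) : seq (nat * nat * f.-tuple nat) :=
  [seq (mn, t) | mn <- [seq (m, n) | m <- iota 0 M.+1, n <- iota 0 M.+1],
                 t <- tuples_le M].

Lemma mem_index_list M m n t :
  ((m, n, t) \in index_list M) = [&& (m <= M)%N, (n <= M)%N & (sumn t <= M)%N].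
Proof.
have hio k : (k \in iota 0 M.+1) = (k <= M)%N by rewrite mem_iota.
rewrite /index_list -mem_tuples_le -!hio; move: (iota 0 M.+1) => s {hio}.
apply/allpairsP/and3P => [[[[m' n'] t'] [/= /allpairsP[[m'' n'']]]]|[hm hn ht]].
  by move=> [/= hm hn [-> ->]] ht [-> -> ->].
by exists (m, n, t); split=> //=; apply/allpairsP; exists (m, n).
Qed.

Lemma uniq_index_list M : uniq (index_list M).
Proof.
apply: allpairs_uniq; [|exact: uniq_tuples_le|by move=> [? ?] [? ?] _ _ [->
    ->]].
by apply: allpairs_uniq; rewrite ?iota_uniq // => -[? ?] [? ?] _ _ [-> ->].
Qed.

Definition index_fset (M : nat) : {fset nat * nat * f.-tuple nat} :=
  [fset x in index_list M]%fset.

Lemma mem_index_fset M x : (x \in index_fset M) = (x \in index_list M).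
Proof. by rewrite /index_fset in_fset. Qed.

Lemma sum_index_fset (V : nmodType) M (F : nat * nat * f.-tuple nat -> V) :
  \sum_(x <- index_fset M) F x =
  \sum_(m < M.+1) \sum_(n < M.+1) \sum_(t <- tuples_le M) F (nat_of_ord m,
      nat_of_ord n, t).
Proof.
rewrite (@perm_big _ _ _ _ _ (index_list M)) /=; last first.
  by apply: uniq_perm; [exact: fset_uniq|exact: uniq_index_list|move=> x;
      rewrite mem_index_fset].
rewrite big_allpairs big_allpairs -[iota _ _]/(index_iota 0 M.+1) big_mkord.
by apply: eq_bigr => m _; rewrite big_mkord.
Qed.

Lemma index_fset_nd M : (index_fset M `<=` index_fset M.+1)%fset.
Proof.
apply/fsubsetP => -[[m n] t]; rewrite !mem_index_fset !mem_index_list =>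
    /and3P[h1 h2 h3].
by rewrite !leqW.
Qed.

Lemma index_fset_exhaust x : exists M, x \in index_fset M.
Proof.
case: x => [[m n] t]; exists (m + n + sumn t)%N.
by rewrite mem_index_fset mem_index_list leq_addl -addnA leq_addr addnCA
    leq_addr.
Qed.

End IndexSets.

(** * The partial sums and their limit *)

Lemma last_le_sumn s : (last 0 s <= sumn s)%N.
Proof.
case: s => // n s /=; elim: s n => [|m s IH] n /=; first by rewrite addn0.
by apply: leq_trans (IH m) _; rewrite leq_addl.
Qed.

Section Summands.
Variables (R : realType) (f : nat).
Local Notation C := (complexNF R).
Variable q : C.
Hypothesis q_lt1 : normc q < 1.

Local Notation qf := (qpoch q q).
Local Notation q3f := (qpoch (q ^+ 3) (q ^+ 3)).
Local Notation u := (fun L : nat => q ^+ (L ^ 2 + L)).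
Local Notation v := (fun n : nat => (qf n)^-1).

Lemma normc0E : normc (0 : C) = 0.
Proof. exact: normc0. Qed.

Lemma normc_expr_lt1 n : normc (q ^+ n.+1) < 1.
Proof. by rewrite normcX exprn_ilt1 ?normc_ge0. Qed.

Lemma q_nonroot n : 1 - q ^+ n.+1 != 0.
Proof.
rewrite subr_eq0; apply/eqP => e; have := normc_expr_lt1 n.
by rewrite -e normc1 ltxx.
Qed.

(** [inner1] and [inner2] collect the factors of the summands that depend on m, n and k = n_f alone;
    the rest is [wgt]. *)
Definition inner1 (m n k : nat) : C :=
  q ^+ (2 * m ^ 2 + 6 * m * n + 6 * n ^ 2 + m + 3 * n) * qf k
     / (qf m * q3f n) * inv_qfact q (k%:Z - (3 * n)%N%:Z - (2 * m)%N%:Z)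
     / qf (2 * k + 1).

Definition inner2 (m n k : nat) : C :=
  q ^+ (2 * m ^ 2 + 6 * m * n + 6 * n ^ 2 + 3 * m + 6 * n) * qf k
     / (qf m * q3f n) * inv_qfact q (k%:Z - (3 * n)%N%:Z - (2 * m)%N%:Z - 1)
     / qf (2 * k + 1).

Lemma wgt_uv (t : f.+1.-tuple nat) :
  wgt u v t = q ^+ (\sum_(1 <= i < f.+2) Npart t i ^ 2)%N *
    q ^+ (\sum_(1 <= i < f.+2) Npart t i)%N /
    \prod_(1 <= i < f.+1) qf (npart t i).
Proof.
have expr_sum (F : nat -> nat) m : q ^+ (\sum_(1 <= i < m) F i)%N = \prod_(1 <=
    i < m) q ^+ F i.
  exact: (big_morph (fun k => q ^+ k) (exprD q) (expr0 q)).
rewrite -wgt_prod prodfV !expr_sum -big_split /=; congr (_ / _).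
by apply: eq_bigr => i _; rewrite exprD.
Qed.

Lemma npart_last (t : f.+1.-tuple nat) : npart t f.+1 = last 0%N t.
Proof. by rewrite /npart (last_nth 0%N) size_tuple; case: t => -[]. Qed.

Lemma summand1E m n (t : f.+1.-tuple nat) :
  summand1 q (m, n, t) = wgt u v t * inner1 m n (last 0%N t).
Proof.
rewrite /summand1 /inner1 npart_last wgt_uv.
set k := last _ _; set i := inv_qfact _ _.
by rewrite !(exprD q (_ + _)%N) !invfM; ring.
Qed.

Lemma summand2E m n (t : f.+1.-tuple nat) :
  summand2 q (m, n, t) = wgt u v t * inner2 m n (last 0%N t).
Proof.
rewrite /summand2 /inner2 npart_last wgt_uv.
set k := last _ _; set i := inv_qfact _ _.
by rewrite !(exprD q (_ + _)%N) !invfM; ring.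
Qed.

(** Both exponents of q are at least m + n, and all factorials and their inverses are bounded
    uniformly. *)
Lemma inner_bound : exists c : R, 0 <= c /\
  forall m n k, normc (inner1 m n k) <= c * normc q ^+ m * normc q ^+ n /\
                normc (inner2 m n k) <= c * normc q ^+ m * normc q ^+ n.
Proof.
have [c [c0 cu cl]] := qpoch_bounds q_lt1.
have [c' [c'0 _ cl']] := qpoch_bounds (normc_expr_lt1 2).
exists (c * (c * c') * c * c); split; first by rewrite !mulr_ge0.
have ci k : normc (inv_qfact q k) <= c by case: k => [k|k]; [exact: cl |
    rewrite /inv_qfact normc0E].
have powle m n e : (m + n <= e)%N -> normc (q ^+ e) <= normc q ^+ m * normc q
    ^+ n.
  move=> mne; rewrite normcX -exprD ler_wiXn2l ?normc_ge0 //; exact: ltW.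
have general m n k e z : (m + n <= e)%N -> 
    normc (q ^+ e * qf k / (qf m * q3f n) * inv_qfact q z / qf (2 * k + 1)) <=
    c * (c * c') * c * c * normc q ^+ m * normc q ^+ n.
  move=> /powle h; rewrite !invfM !normcM.
  rewrite [leRHS](_ : _ = normc q ^+ m * normc q ^+ n * c * (c * c') * c * c);
      last by ring.
  by rewrite !ler_pM ?mulr_ge0 ?normc_ge0.
by move=> m n k; split; apply: general; lia.
Qed.

(** The sums over m and n are geometric, and the tuples of sum L contribute at most r^L times the
    constant of [chain_bound]. *)
Lemma abs_bounded (b : nat -> nat -> nat -> C) (c : R) : 0 <= c ->
  (forall m n k, normc (b m n k) <= c * normc q ^+ m * normc q ^+ n) ->
  exists B : R, forall M,
  \sum_(x <- index_fset f.+1 M)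
     normc (wgt u v x.2 * b x.1.1 x.1.2 (last 0%N x.2)) <= B.
Proof.
move=> c0 hb; set r := normc q; have r0 : 0 <= r := normc_ge0 q.
have [d [d0 _ dl]] := qpoch_bounds q_lt1.
have r1' : 0 <= (1 - r)^-1 by rewrite invr_ge0 subr_ge0 ltW.
pose D := (d / (1 - r)) ^+ f.
have D0 : 0 <= D by rewrite exprn_ge0 // mulr_ge0.
exists (c * (1 - r)^-1 * (1 - r)^-1 * (D * (1 - r)^-1)) => M.
rewrite sum_index_fset /=.
pose W s : R := wgt (fun n => r ^+ n) (fun=> d) s.
have hu n : normc (q ^+ (n ^ 2 + n)) <= r ^+ n.
  by rewrite normcX ler_wiXn2l ?leq_addl // ltW.
have hW : \sum_(t <- tuples_le f.+1 M) W (val t) <= D * (1 - r)^-1.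
  rewrite sum_tuples_le.
  apply: (@le_trans _ _ (\sum_(L < M.+1) D * r ^+ L)); last first.
    by rewrite -mulr_sumr ler_wpM2l ?geometric_sum_le.
  apply: ler_sum => L _.
  rewrite [leLHS](_ : _ = r ^+ L * chain (fun n => r ^+ n) (fun=> d) (fun=> 1)
      f L);
    last by rewrite -sum_comps; apply: eq_bigr => s _; rewrite mulr1.
  rewrite mulrC ler_wpM2r ?exprn_ge0 //.
  have r01 : 0 <= r < 1 by rewrite r0.
  by have /andP[_] := @chain_bound R r d 1 f L r01 d0 ler01; rewrite mul1r.
apply: (@le_trans _ _ (\sum_(m < M.+1) \sum_(n < M.+1)
    (c * r ^+ m * r ^+ n) * \sum_(t <- tuples_le f.+1 M) W (val t))).
  apply: ler_sum => m _; apply: ler_sum => n _; rewrite mulr_sumr.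
  apply: ler_sum => t _; rewrite normcM mulrC ler_pM ?normc_ge0 //.
  exact: wgt_bound.
apply: (@le_trans _ _ (\sum_(m < M.+1) \sum_(n < M.+1)
    (c * r ^+ m * r ^+ n) * (D * (1 - r)^-1))).
  apply: ler_sum => m _; apply: ler_sum => n _.
  by rewrite ler_wpM2l // !mulr_ge0 ?exprn_ge0.
under eq_bigr => m _ do rewrite -mulr_suml -mulr_sumr.
rewrite -mulr_suml ler_wpM2r ?mulr_ge0 //.
rewrite -mulr_suml -mulr_sumr.
by rewrite !ler_pM ?mulr_ge0 ?sumr_ge0 ?geometric_sum_le // => *; rewrite
    exprn_ge0.
Qed.

Lemma summands_exhaust :
  [/\ uncond_summable (@summand1 C f.+1 q), uncond_summable (@summand2 C f.+1
      q) &
   (\sum_(x <- index_fset f.+1 M) (summand1 q x + q * summand2 q x)) @[M -->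
       \oo]
     --> uncond_sum (@summand1 C f.+1 q) + q * uncond_sum (@summand2 C f.+1 q)].
Proof.
have [c [c0 hc]] := inner_bound.
have [B1 hB1] := abs_bounded c0 (fun m n k => proj1 (hc m n k)).
have [B2 hB2] := abs_bounded c0 (fun m n k => proj2 (hc m n k)).
have [s1 l1] : uncond_summable (@summand1 C f.+1 q) /\
    (\sum_(x <- index_fset f.+1 M) summand1 q x @[M --> \oo] --> uncond_sum
        (@summand1 C f.+1 q)).
  apply: (@uncond_sum_exhaust _ _ _ _ B1); [exact: index_fset_nd|exact:
      index_fset_exhaust|].
  move=> M; apply: le_trans (hB1 M); apply: ler_sum => -[[m n] t] _.
  by rewrite summand1E.
have [s2 l2] : uncond_summable (@summand2 C f.+1 q) /\
    (\sum_(x <- index_fset f.+1 M) summand2 q x @[M --> \oo] --> uncond_sum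
        (@summand2 C f.+1 q)).
  apply: (@uncond_sum_exhaust _ _ _ _ B2); [exact: index_fset_nd|exact:
      index_fset_exhaust|].
  move=> M; apply: le_trans (hB2 M); apply: ler_sum => -[[m n] t] _.
  by rewrite summand2E.
split; [exact: s1|exact: s2|].
have -> : (fun M => \sum_(x <- index_fset f.+1 M) (summand1 q x + q * summand2
    q x)) =
    (fun M => \sum_(x <- index_fset f.+1 M) summand1 q x +
              q * \sum_(x <- index_fset f.+1 M) summand2 q x).
  by apply/funext => M; rewrite big_split mulr_sumr.
exact: (cvgD l1 (cvgM (cvg_cst q) l2)).
Qed.

Variable w : C.
Hypothesis w_root : w ^+ 2 + w + 1 = 0.

(** The beta sequence of the Bailey pair after k steps of the chain, in closed form. *)
Definition beta (k L : nat) : C :=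
  \sum_(r < L.+1) wcoef w r * q ^+ (r ^ 2 + r) * q ^+ (k * (r ^ 2 + r))
    / (qf (L - r) * qf (L + r + 1)).

Lemma chain_beta k L :
  chain u v (fun L => Tfun q L (Gser q w) / qf (2 * L + 1)) k L = beta k L.
Proof.
rewrite /beta -(chain_bailey q_nonroot (fun r => wcoef w r * q ^+ (r ^ 2 + r))).
congr (chain _ _ _ k L); apply/funext => j.
by rewrite (beta_sum q_nonroot w_root).
Qed.

(** For a fixed tuple the sums over m and n are evaluated by [inner_sum]; the tuples with N_1 = L
    then form the chain. *)
Lemma sum_index_fset_beta M :
  \sum_(x <- index_fset f.+1 M) (summand1 q x + q * summand2 q x) =
  \sum_(L < M.+1) q ^+ (L ^ 2 + L) * beta f L.
Proof.
pose F (x : nat * nat * f.+1.-tuple nat) := summand1 q x + q * summand2 q x.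
rewrite (sum_index_fset M F).
pose b k := Tfun q k (Gser q w) / qf (2 * k + 1).
pose G s := wgt u v s * b (last 0%N s).
transitivity (\sum_(t <- tuples_le f.+1 M) G (val t)).
  under eq_bigr => m _ do rewrite exchange_big /=.
  rewrite exchange_big /=; apply: eq_big_seq => t.
  rewrite mem_tuples_le => tM.
  (* n_f <= N_1 <= M, so the box m, n <= M contains the whole support of the inner sums. *)
  have kM : (last 0 t < M.+1)%N by rewrite ltnS (leq_trans (last_le_sumn _) tM).
  rewrite /G /b -(inner_sum q_nonroot w_root kM) mulr_suml mulr_sumr.
  apply: eq_bigr => m _; rewrite mulr_suml mulr_sumr; apply: eq_bigr => n _.
  by rewrite /F summand1E summand2E /inner1 /inner2; ring.
rewrite (sum_tuples_le f.+1 M G); apply: eq_bigr => L _.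
by rewrite /G (sum_comps _ _ b) chain_beta.
Qed.

End Summands.

(** * Evaluation of the Jacobi product by residues modulo 6 *)

Section JacobiProduct.
Variable K : numFieldType.

Lemma qpoch_power_neq0 (p : K) d M : (forall n, 1 - p ^+ n.+1 != 0) ->
  qpoch (p ^+ d.+1) (p ^+ d.+1) M != 0.
Proof.
move=> nr; apply: qf_neq0 => n; rewrite -exprM.
by rewrite (_ : d.+1 * n.+1 = (d * n.+1 + n).+1)%N //; lia.
Qed.

(** 1 - x + x^2 = (1 - x^6)(1 - x)/((1 - x^3)(1 - x^2)) at x = p^(k+1). *)
Lemma jacobi_prod_qpoch (p : K) M : (forall n, 1 - p ^+ n.+1 != 0) ->
  \prod_(k < M) (1 - p ^+ k.+1 + (p ^+ k.+1) ^+ 2) =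
  qpoch (p ^+ 6) (p ^+ 6) M * qpoch p p M /
  (qpoch (p ^+ 3) (p ^+ 3) M * qpoch (p ^+ 2) (p ^+ 2) M).
Proof.
move=> nr; have nz d := @qpoch_power_neq0 p d M nr.
apply: (mulIf (mulf_neq0 (nz 2) (nz 1))).
rewrite divfK ?mulf_neq0 //; elim: M {nz} => [|M IH].
  by rewrite !qpoch0 big_ord0 !mulr1.
rewrite big_ord_recr /= !qpochS.
have ex x : p ^+ x * (p ^+ x) ^+ M = (p ^+ M.+1) ^+ x.
  by rewrite -exprS -!exprM mulnC.
rewrite (ex 6) (ex 3) (ex 2) -(exprS p M).
by move: (p ^+ M.+1) => X; rewrite [RHS]mulrACA -IH; ring.
Qed.

Lemma prod_ord2 (F : nat -> K) : \prod_(a < 2) F a = F 0%N * F 1%N.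
Proof. by rewrite !big_ord_recl big_ord0 mulr1. Qed.

Lemma prod_ord3 (F : nat -> K) : \prod_(a < 3) F a = F 0%N * F 1%N * F 2%N.
Proof. by rewrite !big_ord_recl big_ord0 mulr1 !mulrA. Qed.

Lemma prod_ord6 (F : nat -> K) :
  \prod_(a < 6) F a = F 0%N * F 1%N * F 2%N * F 3%N * F 4%N * F 5%N.
Proof. by rewrite !big_ord_recl big_ord0 mulr1 !mulrA. Qed.

(** The letters a, b, c, d, e, g stand for (p^i;p^6)_oo with i = 1, ..., 6. *)
Lemma jacobi_cancel (a b c d e g : K) : b != 0 -> c != 0 -> d != 0 -> g != 0 ->
  a * e = g * (a * b * c * d * e * g) / (c * g * (b * d * g)).
Proof. by move=> b0 c0 d0 g0; field; rewrite b0 c0 d0 g0. Qed.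

End JacobiProduct.

Section ProductLimits.
Variable R : realType.
Local Notation C := (complexNF R).

(** Sorts the factors 1 - p^i by the residue of i modulo d. *)
Lemma qpoch_dissect (p : C) d M :
  qpoch p p (d * M) = \prod_(a < d) qpoch (p ^+ a.+1) (p ^+ d) M.
Proof.
elim: M => [|M IH].
  by rewrite muln0 qpoch0 big1 // => a _; rewrite qpoch0.
rewrite mulnSr {1}/qpoch big_split_ord /= -/(qpoch p p (d * M)) IH -big_split
    /=.
apply: eq_bigr => a _; rewrite qpochS -exprM -exprS -exprD; congr (_ * (1 - _
    ^+ _)).
by rewrite addSn addnC.
Qed.

Lemma cvg_prod_ord d (F : 'I_d -> nat -> C) (l : 'I_d -> C) :
  (forall a, F a M @[M --> \oo] --> l a) ->
  \prod_a F a M @[M --> \oo] --> \prod_a l a.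
Proof.
elim: d F l => [|d IH] F l h.
  under eq_fun do rewrite big_ord0; rewrite big_ord0; exact: cvg_cst.
under eq_fun do rewrite big_ord_recl; rewrite big_ord_recl.
by apply: cvgM => //; exact: IH.
Qed.

Lemma qpoch_inf_dissect (p : C) d : normc p < 1 ->
  qpoch_inf p p = \prod_(a < d.+1) qpoch_inf (p ^+ a.+1) (p ^+ d.+1).
Proof.
move=> p1.
have h1 : qpoch p p (d.+1 * M) @[M --> \oo] --> qpoch_inf p p.
  apply: (@cvg_comp _ _ _ (muln d.+1) (qpoch p p) \oo \oo); first exact:
      cvg_mulnl.
  exact: cvg_qpoch.
have h2 : qpoch p p (d.+1 * M) @[M --> \oo] -->
    \prod_(a < d.+1) qpoch_inf (p ^+ a.+1) (p ^+ d.+1).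
  under eq_fun do rewrite qpoch_dissect.
  by apply: cvg_prod_ord => a; apply: cvg_qpoch; exact: normc_expr_lt1.
rewrite -(cvg_lim (@norm_hausdorff _ _) h1); exact: (cvg_lim (@norm_hausdorff _
    _) h2).
Qed.

Lemma qpoch_inf_power (p : C) d e : normc p < 1 ->
  qpoch_inf (p ^+ d.+1) (p ^+ d.+1) =
  \prod_(a < e.+1) qpoch_inf (p ^+ (d.+1 * a.+1)) (p ^+ (d.+1 * e.+1)).
Proof.
move=> p1; rewrite (@qpoch_inf_dissect _ e (normc_expr_lt1 p1 d)).
by apply: eq_bigr => a _; rewrite !(exprM p).
Qed.

(** When the four products of [jacobi_prod_qpoch] are split by residues modulo 6, only the classes 1
    and 5 survive the cancellation. *)
Lemma cvg_jacobi_prod (p : C) : normc p < 1 ->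
  \prod_(k < M) (1 - p ^+ k.+1 + (p ^+ k.+1) ^+ 2) @[M --> \oo] -->
  qpoch_inf p (p ^+ 6) * qpoch_inf (p ^+ 5) (p ^+ 6).
Proof.
move=> p1; have q1 d := normc_expr_lt1 p1 d.
have P0 a : qpoch_inf (p ^+ a.+1) (p ^+ 6) != 0.
  by apply: qpoch_inf_neq0; [exact: (q1 a)|exact: (q1 5%N)].
pose P a := qpoch_inf (p ^+ a) (p ^+ 6).
have e1 : qpoch_inf p p = P 1%N * P 2%N * P 3%N * P 4%N * P 5%N * P 6%N :=
  etrans (@qpoch_inf_dissect p 5 p1) (prod_ord6 (fun a => P a.+1)).
have e2 : qpoch_inf (p ^+ 2) (p ^+ 2) = P 2%N * P 4%N * P 6%N :=
  etrans (@qpoch_inf_power p 1 2 p1) (prod_ord3 (fun a => P (2 * a.+1)%N)).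
have e3 : qpoch_inf (p ^+ 3) (p ^+ 3) = P 3%N * P 6%N :=
  etrans (@qpoch_inf_power p 2 1 p1) (prod_ord2 (fun a => P (3 * a.+1)%N)).
have nz2 : qpoch_inf (p ^+ 2) (p ^+ 2) != 0.
  by apply: qpoch_inf_neq0; exact: (q1 1%N).
have nz3 : qpoch_inf (p ^+ 3) (p ^+ 3) != 0.
  by apply: qpoch_inf_neq0; exact: (q1 2%N).
have -> : (fun M => \prod_(k < M) (1 - p ^+ k.+1 + (p ^+ k.+1) ^+ 2)) =
    (fun M => qpoch (p ^+ 6) (p ^+ 6) M * qpoch p p M /
      (qpoch (p ^+ 3) (p ^+ 3) M * qpoch (p ^+ 2) (p ^+ 2) M)).
  by apply/funext => M; exact: (jacobi_prod_qpoch M (q_nonroot p1)).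
have -> : qpoch_inf p (p ^+ 6) * qpoch_inf (p ^+ 5) (p ^+ 6) =
    qpoch_inf (p ^+ 6) (p ^+ 6) * qpoch_inf p p /
    (qpoch_inf (p ^+ 3) (p ^+ 3) * qpoch_inf (p ^+ 2) (p ^+ 2)).
  rewrite e1 e2 e3; exact: jacobi_cancel (P0 1%N) (P0 2%N) (P0 3%N) (P0 5%N).
apply: cvgM.
  by apply: cvgM; apply: cvg_qpoch; [exact: (q1 5%N)|exact: p1].
apply: cvgV; first exact (mulf_neq0 nz3 nz2).
by apply: cvgM; apply: cvg_qpoch; [exact: (q1 2%N)|exact: (q1 1%N)].
Qed.

End ProductLimits.

(** * Limits of the theta series and of the chain *)

Section MainLimit.
Variables (R : realType) (f : nat).
Local Notation C := (complexNF R).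
Variables q w : C.
Hypothesis q_lt1 : normc q < 1.
Hypothesis w_root : w ^+ 2 + w + 1 = 0.

Local Notation qf := (qpoch q q).
Local Notation qinf := (qpoch_inf q q).
Local Notation Q := (q ^+ (2 * (f.+1 + 1))).
Local Notation Qf := (qpoch Q Q).
Local Notation Qinf := (qpoch_inf Q Q).

Lemma Q_lt1 : normc Q < 1.
Proof. by rewrite (_ : 2 * (f.+1 + 1) = (2 * f + 3).+1)%N; [exact:
    normc_expr_lt1|lia]. Qed.

Lemma normc_wcoef r : normc (wcoef w r) <= 2.
Proof.
have w1 : normc w = 1.
  apply/eqP; rewrite -(@pexpr_eq1 _ _ 3) ?normc_ge0 // -normcX.
  by rewrite (w_cube w_root) [normc _]normc1.
rewrite /wcoef normcNE; apply: le_trans (ler_normcD _ _) _.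
by rewrite !normcM !normcX w1 !expr1n !mulr1.
Qed.

(** Written in base [Q], where the theta series is a Jacobi triple product; the number of indices
    n_i is [f.+1] here. *)
Definition theta_term r : C := wcoef w r * Q ^+ 'C(r.+1, 2).

Lemma theta_termE r :
  theta_term r = wcoef w r * q ^+ (r ^ 2 + r) * q ^+ (f.+1 * (r ^ 2 + r)).
Proof.
rewrite /theta_term -exprM -mulrA -exprD; congr (_ * _ ^+ _).
have binE k : ('C(k.+1, 2) * 2 = k ^ 2 + k)%N.
  by elim: k => // k IH; rewrite binS bin1 mulnDl IH; lia.
by rewrite -binE; lia.
Qed.

Lemma normc_term_le (z : C) (e r : nat) : normc z <= 2 -> (r <= e)%N ->
  normc (z * q ^+ e) <= 2 * normc q ^+ r.
Proof.
move=> hz re; rewrite normcM ler_pM ?normc_ge0 // normcX ler_wiXn2l ?normc_ge0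
    //.
exact: ltW.
Qed.

Lemma normc_theta_term r : normc (theta_term r) <= 2 * normc q ^+ r.
Proof.
rewrite theta_termE -mulrA -exprD; apply: normc_term_le; first exact:
    normc_wcoef.
by lia.
Qed.

Lemma beta_bounded k : exists B : R, forall L, normc (beta q w k L) <= B.
Proof.
have [c [c0 _ cl]] := qpoch_bounds q_lt1.
exists (2 * c * c * (1 - normc q)^-1) => L.
apply: le_trans (ler_normc_sum _ _ _) _.
apply: (@le_trans _ _ (\sum_(r < L.+1) 2 * c * c * normc q ^+ r)); last first.
  by rewrite -mulr_sumr ler_wpM2l ?mulr_ge0 ?geometric_sum_le ?normc_ge0.
apply: ler_sum => r _; rewrite -(mulrA (wcoef w r)) -exprD invfM mulrA !normcM.
rewrite [leRHS](_ : _ = 2 * normc q ^+ r * c * c); last by ring.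
rewrite !ler_pM ?mulr_ge0 ?normc_ge0 ?normc_wcoef // normcX.
by rewrite ler_wiXn2l ?normc_ge0 //; [exact: ltW | lia].
Qed.

Lemma cvg_qpoch_sub (p : C) r : normc p < 1 ->
  qpoch p p (M - r) @[M --> \oo] --> qpoch_inf p p.
Proof.
move=> p1; apply: (@cvg_comp _ _ _ (subn^~ r) (qpoch p p) \oo \oo).
  exact: cvg_subnr.
exact: cvg_qpoch.
Qed.

Lemma cvg_qpoch_add (p : C) r : normc p < 1 ->
  qpoch p p (M + r + 1) @[M --> \oo] --> qpoch_inf p p.
Proof.
move=> p1; under eq_fun do rewrite -addnA.
apply: (@cvg_comp _ _ _ (addn^~ (r + 1)%N) (qpoch p p) \oo \oo).
  exact: cvg_addnr.
exact: cvg_qpoch.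
Qed.

Lemma cvg_qpoch_double (p : C) : normc p < 1 ->
  qpoch p p (2 * M + 1) @[M --> \oo] --> qpoch_inf p p.
Proof.
move=> p1; apply: (@cvg_comp _ _ _ (fun M => 2 * M + 1)%N (qpoch p p) \oo \oo).
  apply: (@cvg_comp _ _ _ (muln 2) (addn^~ 1%N) \oo \oo); first exact:
      cvg_mulnl.
  exact: cvg_addnr.
exact: cvg_qpoch.
Qed.

(** The finite Jacobi product is the theta sum with weights tending to 1/(Q;Q)_oo, and Tannery's
    theorem removes the weights. *)
Lemma cvg_theta : \sum_(r < M.+1) theta_term r @[M --> \oo] -->
  Qinf * (qpoch_inf Q (Q ^+ 6) * qpoch_inf (Q ^+ 5) (Q ^+ 6)).
Proof.
have Q1 := Q_lt1; have Q0 : Qinf != 0 by exact: qpoch_inf_neq0.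
have [c [c0 cu cl]] := qpoch_bounds Q1.
have r01 : 0 <= normc q < 1 by rewrite normc_ge0.
(* For r > M truncated subtraction gives (Q;Q)_0 = 1; only r <= M occurs in the sums. *)
pose x M r := Qf (2 * M + 1) * ((Qf (M - r))^-1 * (Qf (M + r + 1))^-1).
have h : \sum_(r < M.+1) theta_term r * x M r - Qinf^-1 * \sum_(r < M.+1)
    theta_term r
    @[M --> \oo] --> (0 : C).
  apply: (@tannery R theta_term x Qinf^-1 (normc q) 2 (c * (c * c)) r01
    normc_theta_term) => [M r|r].
    by rewrite !normcM !ler_pM ?mulr_ge0 ?normc_ge0.
  have := cvgM (cvg_qpoch_double Q1)
    (cvgM (cvgV Q0 (cvg_qpoch_sub r Q1)) (cvgV Q0 (cvg_qpoch_add r Q1))).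
  by rewrite mulrA divff // mul1r; exact.
have nr : forall n, 1 - Q ^+ n.+1 != 0 := q_nonroot Q1.
have prodE M : \sum_(r < M.+1) theta_term r * x M r =
    \prod_(k < M) (1 - Q ^+ k.+1 + (Q ^+ k.+1) ^+ 2).
  rewrite -(jacobi_finite nr w_root); apply: eq_bigr => r _; congr (_ * _).
  have rM : (r <= M)%N by rewrite -ltnS.
  rewrite /x /qbin (_ : (M - r <= 2 * M + 1)%N); last by lia.
  by rewrite (_ : 2 * M + 1 - (M - r) = M + r + 1)%N ?invfM //; lia.
have l1 : \prod_(k < M) (1 - Q ^+ k.+1 + (Q ^+ k.+1) ^+ 2) -
    (\sum_(r < M.+1) theta_term r * x M r - Qinf^-1 * \sum_(r < M.+1)
        theta_term r)
    @[M --> \oo] --> qpoch_inf Q (Q ^+ 6) * qpoch_inf (Q ^+ 5) (Q ^+ 6).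
  rewrite -[X in _ --> X]subr0; apply: cvgB; [exact: (cvg_jacobi_prod
      Q1)|exact: h].
(* Solves the Tannery difference for the theta sum, which also proves its convergence. *)
have -> : (fun M => \sum_(r < M.+1) theta_term r) =
    (fun M => Qinf * (\prod_(k < M) (1 - Q ^+ k.+1 + (Q ^+ k.+1) ^+ 2) -
    (\sum_(r < M.+1) theta_term r * x M r - Qinf^-1 * \sum_(r < M.+1)
        theta_term r))).
  by apply/funext => M; rewrite prodE opprB addrC subrK mulVKf.
by apply: cvgM; [exact: cvg_cst|exact: l1].
Qed.

(** (q)_M times the beta sequence after f + 1 steps is written in two ways, as a chain step from
    [beta q w f] and as an explicit theta sum; Tannery's theorem applies to both. *)
Lemma cvg_sum_beta :
  \sum_(L < M.+1) q ^+ (L ^ 2 + L) * beta q w f L @[M --> \oo] -->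
  qinf^-1 * (Qinf * (qpoch_inf Q (Q ^+ 6) * qpoch_inf (Q ^+ 5) (Q ^+ 6))).
Proof.
have q0 : qinf != 0 by exact: qpoch_inf_neq0.
have [c [c0 cu cl]] := qpoch_bounds q_lt1.
have [B hB] := beta_bounded f.
have r01 : 0 <= normc q < 1 by rewrite normc_ge0.
pose b L := q ^+ (L ^ 2 + L) * beta q w f L.
(* The weights (q)_M/(q)_{M-L} of the last chain step tend to 1. *)
have h1 : \sum_(L < M.+1) b L * (qf M * (qf (M - L))^-1) - 1 * \sum_(L < M.+1)
    b L
    @[M --> \oo] --> (0 : C).
  apply: (@tannery R b (fun M L => qf M * (qf (M - L))^-1) 1 (normc q) B (c *
      c))
    => // [L|M r|r].
  - rewrite /b normcM mulrC ler_pM ?normc_ge0 // normcX ler_wiXn2l ?normc_ge0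
      ?leq_addl //.
    exact: ltW.
  - by rewrite !normcM !ler_pM ?mulr_ge0 ?normc_ge0.
  have := cvgM (@cvg_qpoch _ q q q_lt1) (cvgV q0 (cvg_qpoch_sub r q_lt1)).
  by rewrite divff //; exact.
(* In the explicit form the weights tend to 1/(q)_oo. *)
have h2 : \sum_(r < M.+1) theta_term r * (qf M * ((qf (M - r))^-1 * (qf (M + r
    + 1))^-1))
    - qinf^-1 * \sum_(r < M.+1) theta_term r @[M --> \oo] --> (0 : C).
  apply: (@tannery R theta_term
    (fun M r => qf M * ((qf (M - r))^-1 * (qf (M + r + 1))^-1)) qinf^-1 (normc
        q) 2
    (c * (c * c)) r01 normc_theta_term) => [M r|r].
    by rewrite !normcM !ler_pM ?mulr_ge0 ?normc_ge0.
  rewrite -[X in _ --> X](mulVKf q0); apply: cvgM; first exact: cvg_qpoch.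
  apply: cvgM; apply: (cvgV q0); first exact: cvg_qpoch_sub.
  exact: cvg_qpoch_add.
have e1 M : \sum_(L < M.+1) b L * (qf M * (qf (M - L))^-1) = qf M * beta q w
    f.+1 M.
  rewrite -(chain_beta q_lt1 w_root) [chain _ _ _ _ _]/= mulr_sumr.
  apply: eq_bigr => L _; rewrite (chain_beta q_lt1 w_root) /b; ring.
have e2 M : \sum_(r < M.+1) theta_term r * (qf M * ((qf (M - r))^-1 * (qf (M +
    r + 1))^-1))
    = qf M * beta q w f.+1 M.
  rewrite /beta mulr_sumr; apply: eq_bigr => r _.
  by rewrite theta_termE invfM; ring.
(* The weighted sums agree by [e1] and [e2] and cancel, so the wanted sum is a null sequence plus
   the theta sum divided by (q)_oo. *)
have -> : (fun M => \sum_(L < M.+1) q ^+ (L ^ 2 + L) * beta q w f L) =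
  (fun M =>
    (\sum_(r < M.+1) theta_term r * (qf M * ((qf (M - r))^-1 * (qf (M + r +
        1))^-1))
      - qinf^-1 * \sum_(r < M.+1) theta_term r)
    - (\sum_(L < M.+1) b L * (qf M * (qf (M - L))^-1) - 1 * \sum_(L < M.+1) b L)
    + qinf^-1 * \sum_(r < M.+1) theta_term r).
  apply/funext => M; by rewrite e1 e2 mul1r [RHS]addrAC subrK subKr.
rewrite -[X in _ --> X]add0r; apply: cvgD.
  by rewrite -[X in _ --> X](subr0 0); apply: cvgB; [exact: h2|exact: h1].
by apply: cvgM; [exact: cvg_cst|exact: cvg_theta].
Qed.

End MainLimit.

(** * Choice of the cube root and conclusion by uniqueness of limits *)

Lemma exists_cube_root (R : realType) : exists w : complexNF R, w ^+ 2 + w + 1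
    = 0.
Proof.
pose s : complexNF R := sqrtc (- 3%:R).
have e : s ^+ 2 = - 3%:R by exact: sqr_sqrtc.
exists ((s - 1) / 2).
have -> : ((s - 1) / 2) ^+ 2 + (s - 1) / 2 + 1 = (s ^+ 2 + 3%:R) / 4%:R by
    field.
by rewrite e addNr mul0r.
Qed.

Lemma sum_summands (R : realType) (f : nat) (q : complexNF R) : normc q < 1 ->
  [/\ uncond_summable (@summand1 _ f.+1 q),
      uncond_summable (@summand2 _ f.+1 q) &
      uncond_sum (@summand1 _ f.+1 q) + q * uncond_sum (@summand2 _ f.+1 q) =
      qpoch_inf (q ^+ (2 * (f.+1 + 1))) (q ^+ (2 * (f.+1 + 1))) / qpoch_inf q q
      * (qpoch_inf (q ^+ (2 * (f.+1 + 1))) (q ^+ (12 * (f.+1 + 1)))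
         * qpoch_inf (q ^+ (10 * (f.+1 + 1))) (q ^+ (12 * (f.+1 + 1))))].
Proof.
move=> q_lt1; have [w w_root] := exists_cube_root R.
have [s1 s2 lim1] := @summands_exhaust R f q q_lt1.
split; [exact: s1|exact: s2|].
have lim2 := @cvg_sum_beta R f q w q_lt1 w_root.
have e : (fun M => \sum_(x <- index_fset f.+1 M) (summand1 q x + q * summand2 q
    x)) =
    (fun M => \sum_(L < M.+1) q ^+ (L ^ 2 + L) * beta q w f L).
  by apply/funext => M; rewrite (sum_index_fset_beta _ q_lt1 w_root).
rewrite e in lim1.
have nh := @norm_hausdorff (complexNF R) (complexNF R).
rewrite (etrans (esym (cvg_lim nh lim1)) (cvg_lim nh lim2)).
rewrite -!(exprM q (2 * (f.+1 + 1))).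
rewrite (_ : 2 * (f.+1 + 1) * 6 = 12 * (f.+1 + 1))%N; last by lia.
rewrite (_ : 2 * (f.+1 + 1) * 5 = 10 * (f.+1 + 1))%N; last by lia.
by rewrite [LHS]mulrA [_^-1 * _]mulrC.
Qed.

Theorem theorem27 (R : realType) (f : nat) (q : R[i]) :
  (0 < f)%N -> `|q| < 1 ->
  [/\ uncond_summable (@summand1 R[i] f q),
      uncond_summable (@summand2 R[i] f q) &
      uncond_sum (@summand1 R[i] f q) + q * uncond_sum (@summand2 R[i] f q) =
      qpoch_inf (q ^+ (2 * (f + 1))) (q ^+ (2 * (f + 1))) / qpoch_inf q q
      * (qpoch_inf (q ^+ (2 * (f + 1))) (q ^+ (12 * (f + 1)))
         * qpoch_inf (q ^+ (10 * (f + 1))) (q ^+ (12 * (f + 1))))].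
Proof.
case: f => // f _ q1.
by have := @sum_summands R f q; apply; rewrite -ltcR.
Qed.
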